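(* Let $\mathbb{F}_m$ be the last field of a radical tower over $\mathbb{C}(x)$ with generators $\overline{\delta}=(\delta_1,\ldots,\delta_m)$, let $F\in\mathbb{F}_m[w_0,\ldots,w_s]$, and consider the ODE \[(\mathrm{A})\qquad F(x,y,y',\ldots,y^{(s)})=0.\] Let $\overline{a}(x)\in\mathbb{F}_m^{\ell}$ be the tuple of the coefficients of $F$ with respect to $(w_0,\ldots,w_s)$ that are not in $\mathbb{C}(x)$, and let $\mathcal{P}=(x,\overline{a}(x))$, with associated radical variety $\mathcal{V}_{\mathcal{P}}$ and tower variety $\mathcal{V}_{\mathbb{T}}$. Suppose that $\mathcal{V}_{\mathbb{T}}$ is rational. Then: \begin{enumerate} \item $\mathcal{V}_{\mathcal{P}}$ is a rational curve. \item If $\mathcal{Q}(z)=(r(z),\overline{\delta}(r(z)))$ is a rational parametrization of $\mathcal{V}_{\mathbb{T}}$, then the ODE \[(\mathrm{B})\qquad G(r(z),Y(z),\ldots,Y^{(s)}(z))=0,\qquad Y(z)=y(r(z)),\] obtained by applying the change $x=r(z)$ in equation $(\mathrm{A})$, is algebraic. \item Assume that $\mathcal{Q}(z)$ in the previous item is invertible and let $h(\overline{z})$ be its inverse. If $Y(z)$ is a solution of $(\mathrm{B})$, then $Y(h(x,\overline{\delta}(x)))$ is a solution of $(\mathrm{A})$. \end{enumerate}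
   Context: A radical tower over $\mathbb{C}(x)$ is a chain of fields $\mathbb{F}_0=\mathbb{C}(x)\subseteq\dots\subseteq\mathbb{F}_{m}$ with $\mathbb{F}_i=\mathbb{F}_{i-1}(\delta_i)=\mathbb{F}_0(\delta_1,\ldots,\delta_i)$, where $\delta_i^{e_i}=\alpha_i\in\mathbb{F}_{i-1}$ and $e_i\in\mathbb{N}$ is positive. Elements of $\mathbb{F}_m$ are regarded as functions of $x$ after a choice of branches of the radicals. The radical variety $\mathcal{V}_{\mathcal{P}}\subseteq\mathbb{C}^{1+\ell}$ is the Zariski closure of the image of the (branch of the) function $x\mapsto\mathcal{P}(x)=(x,\overline{a}(x))$. The tower variety $\mathcal{V}_{\mathbb{T}}\subseteq\mathbb{C}^{1+m}$ is the Zariski closure of the image of $\psi\colon x\mapsto(x,\overline{\delta}(x))=(x,\delta_1(x),\ldots,\delta_m(x))$. Both are irreducible algebraic curves. A rational parametrization of $\mathcal{V}_{\mathbb{T}}$ is a tuple of rational functions of $z$ defining a dominant rational map $\mathbb{C}\dashrightarrow\mathcal{V}_{\mathbb{T}}$; its first component is called $r(z)$ and its remaining components are denoted $\overline{\delta}(r(z))$, which fixes the meaning of the composite $a(r(z))$ for every $a\in\mathbb{F}_m$ (write $a$ as a rational function of $x,\overline{\delta}$ and substitute $\mathcal{Q}(z)$). The parametrization is invertible if it is birational onto $\mathcal{V}_{\mathbb{T}}$; its inverse is then a rational function $h(\overline{z})$ of $1+m$ variables on $\mathcal{V}_{\mathbb{T}}$ with $h(\mathcal{Q}(z))=z$. A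 curve is rational if it has an invertible rational parametrization. The transformed equation (B) is obtained from (A) by replacing $x$ by $r(z)$ in the coefficients of $F$ and replacing $y^{(j)}(r(z))$ by its expression via the chain rule, $y^{(j)}(r(z))=\left(\frac{1}{r'(z)}\frac{d}{dz}\right)^{j}Y(z)$; this is a polynomial expression in $Y,\ldots,Y^{(s)}$ with coefficients functions of $z$. Equation (B) is called algebraic if all these coefficients are rational functions of $z$. *)

(* Defs.v *)
From HB Require Import structures.
From mathcomp Require Import all_boot all_order all_algebra.
From mathcomp Require Import mathcomp_extra boolp classical_sets functions.
From mathcomp Require Import cardinality reals topology normedtype derive.
From mathcomp Require Import complex.
(* The notations of [mpoly] clash with those of MathComp-Analysis. *)
From mathcomp Require Import -(notations) mpoly.

Set Implicit Arguments.
Unset Strict Implicit.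
Unset Printing Implicit Defensive.

Import Order.TTheory GRing.Theory Num.Theory.
Import numFieldNormedType.Exports.

Local Open Scope classical_set_scope.
Local Open Scope ring_scope.

(* The field of complex numbers, bundled so that the topology and the norm are
   those MathComp-Analysis gives to every numClosedFieldType: [complex R] alone
   comes with a module structure over R, not over itself. *)
Definition Cx (R : realType) : numClosedFieldType := complex R.

(* The point (x, v_1, ..., v_n) of affine (1+n)-space. *)
Definition pcons (T : Type) (n : nat) (x : T) (v : 'I_n -> T) : 'I_n.+1 -> T :=
  fun i => oapp v x (unlift ord0 i).

Section Towers.
Variables (k K : fieldType) (iota : {rmorphism {fraction {poly k}} -> K}).

Definition is_subfield (A : set K) : Prop :=
  [/\ A 1, forall x y, A x -> A y -> A (x - y)
    & forall x y, A x -> A y -> A (x / y)].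

Definition adjoin (A : set K) (x : K) : set K :=
  smallest is_subfield (A `|` [set x]).

(* [Fi i] is the i-th field of the tower, as a subset of the last one, K; the
   i-th generator and exponent, for i = 1, ..., m, have index i - 1 in 'I_m. *)
Record radical_tower (m : nat) (Fi : nat -> set K) (delta : 'I_m -> K)
    (e : 'I_m -> nat) : Prop := RadicalTower {
  tower_base : Fi 0%N = range iota;
  tower_step : forall i : 'I_m, Fi i.+1 = adjoin (Fi i) (delta i);
  tower_exp : forall i : 'I_m, (0 < e i)%N;
  tower_rad : forall i : 'I_m, Fi i (delta i ^+ e i);
  tower_top : Fi m = [set: K]
}.

(* The element P(x, delta) of K. *)
Definition tower_eval (m : nat) (delta : 'I_m -> K) (P : mpoly m.+1 k) : K :=
  mmap (fun c : k => iota (tofrac c%:P)) (pcons (iota (tofrac 'X)) delta) P.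

(* [tower_value delta a p v]: the element a of K, written as a rational
   function N / E of (x, delta), takes the value v at the point p. It is used
   with p = (x, delta(x)), which gives a(x), and with p = Q(z), which gives
   a(r(z)). *)
Definition tower_value (m : nat) (delta : 'I_m -> K) (a : K)
    (p : 'I_m.+1 -> k) (v : k) : Prop :=
  exists N E : mpoly m.+1 k,
    [/\ tower_eval delta E != 0, a = tower_eval delta N / tower_eval delta E,
        meval p E != 0 & v = meval p N / meval p E].

Definition tower_defined (m : nat) (delta : 'I_m -> K) (a : K)
    (p : 'I_m.+1 -> k) : Prop := exists v, tower_value delta a p v.

(* Meaningful only where [tower_defined] holds; 0 elsewhere. *)
Definition tower_fun (m : nat) (delta : 'I_m -> K) (a : K)
    (p : 'I_m.+1 -> k) : k := xget 0 [set v | tower_value delta a p v].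

End Towers.

Section AffineGeometry.
Variable k : fieldType.

Definition zariski_closure (n : nat) (S : set ('I_n -> k)) : set ('I_n -> k) :=
  [set p | forall P : mpoly n k,
     (forall q, S q -> meval q P = 0) -> meval p P = 0].

(* The rational function f is regular at z, with value v. *)
Definition rat_value (f : {fraction {poly k}}) (z v : k) : Prop :=
  exists n d : {poly k},
    [/\ f = tofrac n / tofrac d, d.[z] != 0 & v = n.[z] / d.[z]].

(* Meaningful only where f is regular; 0 elsewhere. *)
Definition rat_fun (f : {fraction {poly k}}) (z : k) : k :=
  xget 0 [set v | rat_value f z v].

Definition param_value (n : nat) (q : 'I_n -> {fraction {poly k}}) (z : k)
    (p : 'I_n -> k) : Prop := forall i, rat_value (q i) z (p i).

Definition param_image (n : nat) (q : 'I_n -> {fraction {poly k}}) :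
  set ('I_n -> k) := [set p | exists z, param_value q z p].

(* A dominant rational map from the affine line to V. *)
Definition rational_parametrization (n : nat) (V : set ('I_n -> k))
    (q : 'I_n -> {fraction {poly k}}) : Prop :=
  param_image q `<=` V /\ V `<=` zariski_closure (param_image q).

(* The quotient h = hN / hE of polynomials in n variables is a rational
   function on V, whose denominator does not vanish identically on V, and both
   composites with q are the identity as rational maps. *)
Definition inverse_parametrization (n : nat) (V : set ('I_n -> k))
    (q : 'I_n -> {fraction {poly k}}) (hN hE : mpoly n k) : Prop :=
  [/\ exists2 p, V p & meval p hE != 0,
      forall z p, param_value q z p -> meval p hE != 0 ->
        meval p hN / meval p hE = z
    & forall p p', V p -> meval p hE != 0 ->
        param_value q (meval p hN / meval p hE) p' -> p' = p].

Definition rational_curve (n : nat) (V : set ('I_n -> k)) : Prop :=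
  exists q : 'I_n -> {fraction {poly k}}, rational_parametrization V q /\
    exists hN hE : mpoly n k, inverse_parametrization V q hN hE.

End AffineGeometry.

Section Branches.
Variables (R : realType) (K : fieldType).
Local Notation C := (Cx R).
Variable iota : {rmorphism {fraction {poly C}} -> K}.

(* Over an open set this is equivalent to complex differentiability, but the
   library has no Cauchy integral formula to bootstrap regularity with. *)
Definition holomorphic (U : set C) (f : C -> C) : Prop :=
  open U /\ forall (j : nat) (x : C), U x -> derivable (derive1n j f) x 1.

(* A choice of branches: holomorphic functions d_1, ..., d_m on a domain D such
   that x |-> x and delta_i |-> d_i define an embedding of C[x, delta] into the
   functions on D, that is, with the same polynomial relations over C as x and
   delta_1, ..., delta_m in K. In particular d_i ^ e_i is the function
   delta_i ^ e_i of x, d_1, ..., d_(i-1). *)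
Record branches (m : nat) (delta : 'I_m -> K) (D : set C)
    (d : 'I_m -> C -> C) : Prop := Branches {
  branches_nonempty : D !=set0;
  branches_connected : connected D;
  branches_open : open D;
  branches_holomorphic : forall i, holomorphic D (d i);
  branches_embedding : forall P : mpoly m.+1 C,
    tower_eval iota delta P = 0 <->
    forall x, D x -> meval (pcons x (d ^~ x)) P = 0
}.

Definition tower_variety (m : nat) (D : set C) (d : 'I_m -> C -> C) :
    set ('I_m.+1 -> C) :=
  zariski_closure [set p | exists2 x, D x & p = pcons x (d ^~ x)].

Definition radical_variety (m : nat) (delta : 'I_m -> K) (D : set C)
    (d : 'I_m -> C -> C) (l : nat) (a : 'I_l -> K) : set ('I_l.+1 -> C) :=
  zariski_closure [set p | exists2 x, D x & exists v : 'I_l -> C,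
    (forall j, tower_value iota delta (a j) (pcons x (d ^~ x)) (v j)) /\
    p = pcons x v].

Definition coefs_defined (m : nat) (delta : 'I_m -> K) (s : nat)
    (F : mpoly s.+1 K) (p : 'I_m.+1 -> C) : Prop :=
  forall mu, mu \in msupp F -> tower_defined iota delta (mcoeff mu F) p.

(* y is a local solution of (A), on the open subset U of D: at the points where
   a coefficient is undefined the equation imposes nothing. *)
Definition solutionA (m : nat) (delta : 'I_m -> K) (D : set C)
    (d : 'I_m -> C -> C) (s : nat) (F : mpoly s.+1 K) (U : set C)
    (y : C -> C) : Prop :=
  [/\ U `<=` D, holomorphic U y
    & forall x, U x -> coefs_defined delta F (pcons x (d ^~ x)) ->
        mmap (fun c => tower_fun iota delta c (pcons x (d ^~ x)))
             (fun j : 'I_s.+1 => derive1n j y x) F = 0].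

(* ((1 / r') d/dz)^j Y = \sum_i (chain_coef r j i) Y^(i) *)
Fixpoint chain_coef (r : C -> C) (j i : nat) : C -> C :=
  match j with
  | 0%N => fun=> (i == 0%N)%:R
  | j'.+1 => fun z =>
      (derive1 (chain_coef r j' i) z +
       (if i is i'.+1 then chain_coef r j' i' z else 0)) / derive1 r z
  end.

(* The left-hand side of (B) at z, as a polynomial in Y, ..., Y^(s). *)
Definition eqB (m : nat) (delta : 'I_m -> K) (s : nat) (F : mpoly s.+1 K)
    (q : 'I_m.+1 -> {fraction {poly C}}) (z : C) : mpoly s.+1 C :=
  mmap (fun c => mpolyC s.+1 (tower_fun iota delta c (fun i => rat_fun (q i) z)))
       (fun j : 'I_s.+1 => \sum_(i < s.+1)
          chain_coef (rat_fun (q ord0)) j i z *: mpolyX C (mnm1 i)) F.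

Definition eqB_defined (m : nat) (delta : 'I_m -> K) (s : nat)
    (F : mpoly s.+1 K) (q : 'I_m.+1 -> {fraction {poly C}}) (z : C) : Prop :=
  [/\ exists p, param_value q z p, derive1 (rat_fun (q ord0)) z != 0
    & coefs_defined delta F (fun i => rat_fun (q i) z)].

(* Each coefficient of (B), as a function of z, is defined and agrees with a
   rational function outside a finite set. *)
Definition algebraicB (m : nat) (delta : 'I_m -> K) (s : nat)
    (F : mpoly s.+1 K) (q : 'I_m.+1 -> {fraction {poly C}}) : Prop :=
  forall mu : multinom s.+1, exists f : {fraction {poly C}},
    finite_set [set z | ~ (eqB_defined delta F q z /\
                           rat_value f z (mcoeff mu (eqB delta F q z)))].

Definition solutionB (m : nat) (delta : 'I_m -> K) (s : nat)
    (F : mpoly s.+1 K) (q : 'I_m.+1 -> {fraction {poly C}}) (W : set C)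
    (Y : C -> C) : Prop :=
  holomorphic W Y /\
  forall z, W z -> eqB_defined delta F q z ->
    meval (fun i : 'I_s.+1 => derive1n i Y z) (eqB delta F q z) = 0.

End Branches.

(* Main.v *)
Require Import Defs.
From HB Require Import structures.
From mathcomp Require Import all_boot all_order all_algebra.
From mathcomp Require Import mathcomp_extra boolp classical_sets functions.
From mathcomp Require Import cardinality reals topology normedtype derive.
From mathcomp Require Import complex.
From mathcomp Require Import -(notations) mpoly.
From mathcomp Require Import ring.

Set Implicit Arguments.
Unset Strict Implicit.
Unset Printing Implicit Defensive.

Import Order.TTheory GRing.Theory Num.Theory.
Import numFieldNormedType.Exports.

Local Open Scope classical_set_scope.
Local Open Scope ring_scope.

(** Everything rests on one algebraic fact. The branch condition says that the
    ideal of the tower variety is the kernel of P |-> P(x, delta) in the last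
    field K of the tower. A rational parametrization Q(z) of the tower variety
    says that the same ideal is the kernel of P |-> P(Q(z)) in C(z)
    ([parametrization_ideal], [tower_kernel]). As K consists of the quotients of
    polynomials in x and delta, there is a field morphism phi from K to C(z), the
    substitution a |-> a(r(z)) ([tower_pullback]).

    The equation (B) is algebraic because phi maps the coefficients of F to
    rational functions, and because derivatives and quotients of rational
    functions are rational; r is not constant since x is transcendental. All of
    these equalities of functions hold outside a finite set
    ([transformed_equation_algebraic]).

    The variety of (x, a) has the relations between x and a in K as its ideal. Its
    function field C(x, a) is embedded by phi in C(z), so the theorem of Lueroth
    [luroth] provides one rational function t that generates it, and t is an
    invertible parameter of the curve ([radical_variety_rational]).

    If Q is invertible, then g(x) = h(x, delta(x)) is a section of r, so that
    g' = 1 / r'(g) and the derivatives of Y(g(x)) are the expressions that occur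
    in (B) ([chain_rule]). This proves (A) wherever g(x) avoids a finite set of bad
    values. Each of these values is taken finitely often
    ([cofinite_g]), because a nonzero element of C[x, delta] divides a nonzero
    polynomial in x ([tower_divides_univariate]). So the bad points are isolated,
    and (A) extends to them by continuity ([solution_pushforward]). *)

(** * Values of fractions *)

Section FractionValues.
Variables (A : comNzRingType) (K k : fieldType).
Variables (f : {rmorphism A -> K}) (g : {rmorphism A -> k}).

(** [tower_value] and [rat_value] are both of this form, with A a ring of
    polynomials and g the evaluation at a point. *)
Definition fraction_value (a : K) (v : k) : Prop :=
  exists n d : A, [/\ f d != 0, a = f n / f d, g d != 0 & v = g n / g d].

Lemma fraction_value_base n : fraction_value (f n) (g n).
Proof. by exists n, 1; rewrite !rmorph1 !divr1 !oner_eq0. Qed.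

Lemma fraction_valueD a b v w :
  fraction_value a v -> fraction_value b w -> fraction_value (a + b) (v + w).
Proof.
move=> [n [d [fd -> gd ->]]] [n' [d' [fd' -> gd' ->]]].
exists (n * d' + n' * d), (d * d').
by rewrite !(rmorphD, rmorphM) !addf_div // !mulf_neq0.
Qed.

Lemma fraction_valueN a v : fraction_value a v -> fraction_value (- a) (- v).
Proof.
by move=> [n [d [fd -> gd ->]]]; exists (- n), d; rewrite !rmorphN !mulNr.
Qed.

Lemma fraction_valueM a b v w :
  fraction_value a v -> fraction_value b w -> fraction_value (a * b) (v * w).
Proof.
move=> [n [d [fd -> gd ->]]] [n' [d' [fd' -> gd' ->]]].
by exists (n * n'), (d * d'); rewrite !rmorphM !mulf_div !mulf_neq0.
Qed.

Hypothesis sub_ker : forall n, f n = 0 -> g n = 0.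

Lemma fraction_value_uniq a v w :
  fraction_value a v -> fraction_value a w -> v = w.
Proof.
move=> [n [d [fd -> gd ->]]] [n' [d' [fd' /eqP e gd' ->]]].
apply/eqP; rewrite eqr_div //; move: e; rewrite eqr_div // -!rmorphM -subr_eq0.
by rewrite -rmorphB => /eqP/sub_ker; rewrite rmorphB !rmorphM => /subr0_eq ->.
Qed.

Lemma fraction_valueV a v :
  fraction_value a v -> v != 0 -> fraction_value a^-1 v^-1.
Proof.
move=> [n [d [fd -> gd ->]]] v0; have gn : g n != 0.
  by apply: contra_neq v0 => ->; rewrite mul0r.
exists d, n; rewrite !invf_div; split=> //.
by apply: contra_neq gn => /sub_ker.
Qed.

Lemma fraction_value_div a b v w :
  fraction_value a v -> fraction_value b w -> w != 0 ->
  fraction_value (a / b) (v / w).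
Proof. by move=> av bw w0; apply/fraction_valueM/fraction_valueV. Qed.

End FractionValues.

(** Used to pass from functions to their values, with E relating a function to
    its value. The maps cf and cg on the coefficients are arbitrary, because
    [tower_fun] is not a morphism. *)
Lemma mmap_ind2 (S T U : nzRingType) (n : nat) (E : S -> T -> Prop)
    (cf : U -> S) (cg : U -> T) (b : 'I_n -> S) (v : 'I_n -> T)
    (P : mpoly n U) :
  E 0 0 -> E 1 1 ->
  (forall x y x' y', E x y -> E x' y' -> E (x + x') (y + y')) ->
  (forall x y x' y', E x y -> E x' y' -> E (x * x') (y * y')) ->
  (forall i, E (b i) (v i)) ->
  (forall mu, mu \in msupp P -> E (cf (mcoeff mu P)) (cg (mcoeff mu P))) ->
  E (mmap cf b P) (mmap cg v P).
Proof.
move=> E0 E1 hD hM Eb EP; rewrite /mmap big_seq [X in E _ X]big_seq.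
apply: (big_ind2 E E0 hD) => mu mP; apply: (hM); first exact: EP.
apply: (big_ind2 E E1 hM) => i _.
by elim: (mu i) => [|j IH] //; rewrite !exprS; apply: hM.
Qed.

Lemma fraction_value_mmap (A : comNzRingType) (K k : fieldType)
    (f : {rmorphism A -> K}) (g : {rmorphism A -> k}) (C : nzRingType)
    (cf : C -> K) (cg : C -> k) n (b : 'I_n -> K) (v : 'I_n -> k)
    (P : mpoly n C) :
  (forall mu, mu \in msupp P ->
     fraction_value f g (cf (mcoeff mu P)) (cg (mcoeff mu P))) ->
  (forall i, fraction_value f g (b i) (v i)) ->
  fraction_value f g (mmap cf b P) (mmap cg v P).
Proof.
move=> fc fb; apply: mmap_ind2 => //.
- by have := fraction_value_base f g 0; rewrite !rmorph0.
- by have := fraction_value_base f g 1; rewrite !rmorph1.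
- by move=> x y x2 y2 ha hb; apply: fraction_valueD.
- by move=> x y x2 y2 ha hb; apply: fraction_valueM.
Qed.

(** The image of f(n) / f(d) has to be g(n) / g(d), and the equality of the
    kernels makes this independent of the choice of n and d. *)
Lemma fraction_lift (A : comNzRingType) (K L : fieldType)
    (f : {rmorphism A -> K}) (g : {rmorphism A -> L}) :
  (forall n, f n = 0 <-> g n = 0) ->
  (forall x, exists n d, f d != 0 /\ x = f n / f d) ->
  exists phi : {rmorphism K -> L}, forall n, phi (f n) = g n.
Proof.
move=> ker gen.
have sub n : f n = 0 -> g n = 0 by move/ker.
have ex x : exists v, fraction_value f g x v.
  have [n [d [fd ->]]] := gen x; exists (g n / g d), n, d; split=> //.
  by apply: contra_neq fd => /ker.
have [phi phiP] := choice ex.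
have phiE x v : fraction_value f g x v -> phi x = v.
  by move=> xv; apply: (fraction_value_uniq sub (phiP x)).
have phiB : zmod_morphism phi.
  by move=> x y; apply/phiE/fraction_valueD => //; apply/fraction_valueN.
have phiM : monoid_morphism phi.
  split=> [|x y]; last exact/phiE/fraction_valueM.
  by apply: phiE; have := fraction_value_base f g 1; rewrite !rmorph1.
pose phiZ := GRing.isZmodMorphism.Build _ _ phi phiB.
pose phiR := GRing.isMonoidMorphism.Build _ _ phi phiM.
pose Phi : {rmorphism K -> L} := HB.pack phi phiZ phiR.
by exists Phi => n; apply/phiE/fraction_value_base.
Qed.

(** * Subfields *)

Section Subfields.
Variables (K : fieldType) (S : set K).
Hypothesis subS : is_subfield S.

Lemma subfield1 : S 1. Proof. by case: subS. Qed.
Lemma subfieldB x y : S x -> S y -> S (x - y).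
Proof. by case: subS => _ + _; apply. Qed.
Lemma subfield_div x y : S x -> S y -> S (x / y).
Proof. by case: subS => _ _; apply. Qed.
Lemma subfield0 : S 0.
Proof. by rewrite -(subrr 1); apply: subfieldB; exact: subfield1. Qed.
Lemma subfieldD x y : S x -> S y -> S (x + y).
Proof.
move=> Sx Sy; rewrite -[y]opprK -[- y]add0r.
by do 2!apply: subfieldB => //; exact: subfield0.
Qed.
Lemma subfieldM x y : S x -> S y -> S (x * y).
Proof.
move=> Sx Sy; rewrite -[y]invrK -[y^-1]mul1r.
by do 2!apply: subfield_div => //; exact: subfield1.
Qed.

End Subfields.

Lemma quotients_subfield (A : comNzRingType) (K : fieldType)
    (f : {rmorphism A -> K}) :
  is_subfield [set a | exists n d, f d != 0 /\ a = f n / f d].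
Proof.
split.
- by exists 1, 1; rewrite rmorph1 divr1 oner_neq0.
- move=> _ _ [n [d [d0 ->]]] [n' [d' [d'0 ->]]].
  exists (n * d' - n' * d), (d * d').
  rewrite rmorphB !rmorphM mulf_neq0 //; split=> //.
  by rewrite -[X in _ + X]mulNr addf_div // mulNr.
- move=> _ _ [n [d [d0 ->]]] [n' [d' [d'0 ->]]].
  have [e0|n'0] := eqVneq (f n') 0.
    exists 0, 1; rewrite e0 mul0r invr0 mulr0 rmorph0 mul0r.
    by rewrite rmorph1 oner_neq0.
  exists (n * d'), (d * n'); rewrite !rmorphM mulf_neq0 //.
  by rewrite invf_div mulf_div.
Qed.

Section PolyOverSubfield.
Variables (K : fieldType) (S : set K).
Hypothesis subS : is_subfield S.

Definition poly_over (p : {poly K}) := forall i, S p`_i.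

Lemma poly_overB p q : poly_over p -> poly_over q -> poly_over (p - q).
Proof. by move=> Sp Sq i; rewrite coefB; apply: subfieldB. Qed.

Lemma poly_overZ c p : S c -> poly_over p -> poly_over (c *: p).
Proof. by move=> Sc Sp i; rewrite coefZ; apply: subfieldM. Qed.

Lemma poly_over_horner p x : poly_over p -> S x -> S p.[x].
Proof.
move=> Sp Sx; rewrite horner_coef; apply: (big_ind S).
- exact: subfield0.
- by move=> ? ? ? ?; apply: subfieldD.
move=> i _; apply: subfieldM => //.
elim: (i : nat) => [|j IH]; first exact: subfield1.
by rewrite exprS; apply: subfieldM.
Qed.

(** As m is monic, the division algorithm computes with the coefficients of p
    and m in their field and never divides. *)
Lemma poly_over_mod (m p : {poly K}) : m \is monic -> poly_over m ->
  poly_over p ->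
  exists2 r, poly_over r & (size r < size m)%N /\ exists c, p - r = c * m.
Proof.
move=> mm Sm; have [n] := ubnP (size p); elim: n p => // n IH p sp Sp.
have [lt_pm|le_mp] := ltnP (size p) (size m).
  by exists p => //; split=> //; exists 0; rewrite subrr mul0r.
pose s := (size p - size m)%N; pose p' := p - lead_coef p *: (m * 'X^s).
have m0 := monic_neq0 mm.
have p0 : p != 0 by rewrite -size_poly_gt0 (leq_trans _ le_mp) ?size_poly_gt0.
have Sp' : poly_over p'.
  move=> i; rewrite coefB coefZ coefMXn.
  apply: subfieldB => //; apply: subfieldM => //; first exact: Sp.
  by case: ifP => _ //; exact: subfield0.
have szq : size (lead_coef p *: (m * 'X^s)) = size p.
  rewrite size_scale ?lead_coef_eq0 // size_mulXn //.
  by rewrite subnK.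
have sp' : (size p' < size p)%N.
  rewrite ltn_neqAle; apply/andP; split; last first.
    by rewrite (leq_trans (size_polyD _ _)) // size_polyN szq maxnn.
  apply/eqP => e.
  have : lead_coef p' = 0.
    rewrite lead_coefE e coefB coefZ coefMXn.
    have -> : ((size p).-1 < s)%N = false.
      apply/negbTE; rewrite -leqNgt /s leq_subLR.
      rewrite -[X in (X <= _)%N]prednK ?size_poly_gt0 // -add1n leq_add2r.
      by rewrite size_poly_gt0.
    have -> : ((size p).-1 - s)%N = (size m).-1.
      have := subnK le_mp; rewrite -/s => <-.
      by rewrite -{1}[size m]prednK ?size_poly_gt0 // addnS /= addnC addnK.
    by rewrite -!lead_coefE (monicP mm) mulr1 subrr.
  by move/eqP; rewrite lead_coef_eq0 -size_poly_eq0 e size_poly_eq0 (negbTE p0).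
have [|r Sr [sr [c ec]]] := IH p' _ Sp'; first exact: leq_trans sp' _.
exists r => //; split=> //; exists (c + lead_coef p *: 'X^s).
by rewrite mulrDl -ec /p' -scalerAl ['X^s * m]mulrC addrAC subrK.
Qed.

End PolyOverSubfield.

(** * Fractions of polynomials and the Gauss lemma *)

Lemma fraction_quotient (R : idomainType) (f : {fraction R}) :
  exists n d : R, d != 0 /\ f = tofrac n / tofrac d.
Proof.
exists (repr f).1, (repr f).2; split; first exact: denom_ratioP.
have d0 : tofrac (repr f).2 != 0 by rewrite tofrac_eq0 denom_ratioP.
apply: (canRL (mulfK d0)); rewrite -{1}[f]reprK.
case: (repr f) => [[n d] /= hd]; rewrite !piE.
apply/eqmodP; rewrite /= FracField.equivfE /FracField.mulf /=.
by rewrite !numden_Ratio ?mulf_neq0 ?oner_eq0 ?mulr1 // mulrC.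
Qed.

Lemma clear_denominators (A : idomainType) (Z : fieldType)
    (f : {rmorphism A -> Z}) (p : {poly Z}) :
  injective f -> (forall x, exists n d : A, d != 0 /\ x = f n / f d) ->
  exists (D : A) (P : {poly A}), D != 0 /\ f D *: p = map_poly f P.
Proof.
move=> injf gen; elim/poly_ind: p => [|p c [D [P [D0 e]]]].
  by exists 1, 0; rewrite oner_neq0 scaler0 rmorph0.
have [n [d [d0 ->]]] := gen c.
exists (D * d), (d *: P * 'X + (D * n)%:P); split; first by rewrite mulf_neq0.
have fd : f d != 0 by rewrite -(rmorph0 f) (inj_eq injf).
rewrite rmorphD /= [map_poly _ (_ * 'X)]rmorphM /= map_polyX map_polyC.
rewrite map_polyZ -e /= [f (_ * _)]rmorphM [f (_ * n)]rmorphM.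
rewrite scalerDr -!scalerAl scalerA.
rewrite [f D * f d]mulrC; congr (_ + _); rewrite -mul_polyC -polyCM /=.
by rewrite mulrAC mulrCA divff // mulr1 mulrC rmorphM.
Qed.

Section RationalFunctions.
Variable C : fieldType.
Local Notation Z := {fraction {poly C}}.

Definition cfrac : {rmorphism C -> Z} := (@tofrac {poly C} \o polyC)%FUN.

Lemma fraction_coprime (f : Z) :
  exists n d : {poly C}, [/\ d != 0, coprimep n d & f = tofrac n / tofrac d].
Proof.
have [n [d [d0 ->]]] := fraction_quotient f.
have nd0 : (n != 0) || (d != 0) by rewrite d0 orbT.
have := coprimep_div_gcd nd0.
have := divpK (dvdp_gcdr n d); have := divpK (dvdp_gcdl n d).
set g := gcdp n d; set n' := n %/ g; set d' := d %/ g => en ed co.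
have /andP[d'0 g0] : (d' != 0) && (g != 0).
  by rewrite -negb_or -mulf_eq0 ed.
exists n', d'; split=> //.
rewrite -en -ed !rmorphM /= -mulf_div divff ?mulr1 //.
by rewrite tofrac_eq0.
Qed.

End RationalFunctions.

(** The Gauss lemma over an algebraically closed field: a polynomial of C[z][T]
    is primitive when no specialization of z kills it, and a product of
    nonzero polynomials of C[T] is not zero. *)
Section Gauss.
Variable C : closedFieldType.
Implicit Types (M Q A : {poly {poly C}}) (D : {poly C}).

Definition specialize (z : C) M : {poly C} := map_poly (horner_eval z) M.

Definition primitive M := forall z, specialize z M != 0.

Lemma specialize_eq0 z M :
  specialize z M = 0 -> exists M', M = ('X - z%:P)%:P * M'.
Proof.
move=> e; have dv i : ('X - z%:P) %| M`_i.
  have := congr1 (fun p : {poly C} => p`_i) e.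
  rewrite coef_map /= /horner_eval coef0 => e'.
  by rewrite dvdp_XsubCl; apply/rootP.
exists (\poly_(i < size M) (M`_i %/ ('X - z%:P))).
apply/polyP => i; rewrite mul_polyC coefZ coef_poly; case: ltnP => [_|le_i].
  by rewrite mulrC divpK.
by rewrite nth_default // mulr0.
Qed.

(** The factors z - z0 are divided out one at a time. The leading coefficient
    loses one degree at each step, so this ends. *)
Lemma primitive_part M : M != 0 ->
  exists (D : {poly C}) (M' : {poly {poly C}}),
    [/\ D != 0, primitive M' & M = D%:P * M'].
Proof.
have [n] := ubnP (size (lead_coef M)); elim: n M => // n IH M sM M0.
have [prim|] := pselect (primitive M).
  by exists 1, M; rewrite oner_neq0 mul1r.
move=> /existsNP[z /negP]; rewrite negbK => /eqP/specialize_eq0[M' e].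
have M'0 : M' != 0 by apply: contra_neq M0 => M'0; rewrite e M'0 mulr0.
have [|D [M'' [D0 prim e']]] := IH M' _ M'0.
  move: sM; rewrite e lead_coefM lead_coefC.
  by rewrite size_monicM ?monicXsubC ?lead_coef_eq0 ?size_XsubC.
exists (('X - z%:P) * D), M''; split=> //; first by rewrite mulf_neq0 ?polyXsubC_eq0.
by rewrite polyCM -mulrA -e'.
Qed.

(** At a root of D the product M Q vanishes and M does not, so Q does, and the
    corresponding linear factor cancels on both sides. *)
Lemma primitive_dvd D A M Q : D != 0 -> primitive M -> D%:P * A = M * Q ->
  exists Q', A = M * Q'.
Proof.
have [n] := ubnP (size D); elim: n D Q => // n IH D Q sD D0 prim e.
have [sD1|/closed_rootP[z /factor_theorem[D' eD]]] := eqVneq (size D) 1%N.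
  have /size_poly1P[c c0 eD] : size D == 1%N by rewrite sD1.
  exists (c^-1%:P *: Q); rewrite -scalerAr -e -mul_polyC eD mulrA -!polyCM.
  by rewrite mulVf // mul1r.
have e0 : specialize z (M * Q) = 0.
  rewrite -e /specialize rmorphM /= map_polyC /= /horner_eval eD hornerM.
  by rewrite hornerXsubC subrr mulr0 mul0r.
move: e0; rewrite /specialize rmorphM /= => /eqP; rewrite mulf_eq0.
rewrite (negbTE (prim z)) /= => /eqP/specialize_eq0[Q' eQ].
have D'0 : D' != 0 by apply: contra_neq D0 => D'0; rewrite eD D'0 mul0r.
have z0 : ('X - z%:P)%:P != 0 :> {poly {poly C}} by rewrite polyC_eq0 polyXsubC_eq0.
apply: (IH D' Q') => //.
  by move: sD; rewrite eD mulrC size_monicM ?monicXsubC ?size_XsubC.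
apply: (mulfI z0); rewrite [RHS]mulrCA -eQ -e eD polyCM.
by rewrite mulrA [X in X * A]mulrC.
Qed.

End Gauss.

(** * The theorem of Lueroth *)

Section SimpleExtensions.
Variables (C K : fieldType) (f : {rmorphism C -> K}) (t : K).

Definition simple_extension : set K :=
  [set y | exists P Q : {poly C}, (map_poly f Q).[t] != 0 /\
             y = (map_poly f P).[t] / (map_poly f Q).[t]].

Lemma simple_extension_poly P : simple_extension (map_poly f P).[t].
Proof. by exists P, 1; rewrite !rmorph1 hornerC divr1 oner_neq0. Qed.

Lemma simple_extension_subfield : is_subfield simple_extension.
Proof.
exact: (quotients_subfield (horner_eval t \o map_poly f)%FUN).
Qed.

Lemma sub_simple_extension (S : set K) : is_subfield S -> (forall c, S (f c)) ->
  S t -> simple_extension `<=` S.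
Proof.
move=> subS Sf St _ [P [Q [_ ->]]].
have Sp R : S (map_poly f R).[t].
  by apply: poly_over_horner => // i; rewrite coef_map; exact: Sf.
exact: subfield_div.
Qed.

End SimpleExtensions.

Section Luroth.
Variables (C : closedFieldType) (Z : fieldType).
Variable tf : {rmorphism {poly C} -> Z}.
Hypothesis tf_inj : injective tf.
Hypothesis gen : forall y, exists n d : {poly C},
  [/\ d != 0, coprimep n d & y = tf n / tf d].

Let cst : {rmorphism C -> Z} := (tf \o polyC)%FUN.

Lemma horner_cst (p : {poly C}) : (map_poly cst p).[tf 'X] = tf p.
Proof.
elim/poly_ind: p => [|p c IH]; first by rewrite !rmorph0 horner0.
by rewrite !rmorphD !rmorphM /= map_polyX map_polyC hornerMXaddC IH.
Qed.

Lemma tf_eq0 p : (tf p == 0) = (p == 0).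
Proof. by rewrite -(rmorph0 tf) (inj_eq tf_inj). Qed.

Lemma transcendental_nonconstant t P :
  (forall c, t != cst c) -> (map_poly cst P).[t] = 0 -> P = 0.
Proof.
move=> tc; have [r ->] := closed_field_poly_normal P.
rewrite map_polyZ hornerZ rmorph_prod horner_prod => /eqP.
rewrite mulf_eq0 /= tf_eq0 polyC_eq0 => /orP[/eqP ->|].
  by rewrite scale0r.
rewrite prodf_seq_eq0 => /hasP[z _] /=.
by rewrite rmorphB /= map_polyX map_polyC hornerXsubC subr_eq0 (negbTE (tc z)).
Qed.

Lemma nonconstant_free u v a b : v != 0 -> (forall c, tf u / tf v != cst c) ->
  a *: u = b *: v -> a = 0 /\ b = 0.
Proof.
move=> v0 tc e; have [a0|a0] := eqVneq a 0.
  split=> //; move/eqP: e; rewrite a0 scale0r eq_sym scaler_eq0 (negbTE v0) orbF.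
  by move/eqP.
have := tc (a^-1 * b); have -> : u = (a^-1 * b) *: v.
  by rewrite -scalerA -e scalerA mulVf // scale1r.
by rewrite -mul_polyC rmorphM /= mulfK ?tf_eq0 ?eqxx.
Qed.

Variable L : set Z.
Hypothesis subL : is_subfield L.
Hypothesis L_cst : forall c, L (cst c).

Let x := tf 'X.

(** If r = n / d, then n(T) - r d(T) is a nonzero polynomial over L that
    vanishes at tf 'X, so this element is algebraic over L. *)
Lemma minimal_polynomial r : L r -> (forall c, r != cst c) ->
  exists m, [/\ m \is monic, poly_over L m, m.[x] = 0 &
    forall p, poly_over L p -> p.[x] = 0 -> (size p < size m)%N -> p = 0].
Proof.
move=> Lr rc; have [n [d [d0 co er]]] := gen r.
pose good k := `[< exists2 p : {poly Z}, p != 0 &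
  [/\ poly_over L p, p.[x] = 0 & size p = k] >].
have exg : exists k, good k.
  pose p := map_poly cst n - r *: map_poly cst d.
  exists (size p); apply/asboolP; exists p.
    apply/eqP => p0; have [i di] : exists i, d`_i != 0.
      by exists (size d).-1; rewrite -lead_coefE lead_coef_eq0.
    have e : cst n`_i = r * cst d`_i.
      have := congr1 (fun p : {poly Z} => p`_i) p0.
      by rewrite coef0 coefB coefZ !coef_map => /subr0_eq.
    by have := rc (n`_i / d`_i); rewrite fmorph_div e mulfK ?fmorph_eq0 ?eqxx.
  split=> //.
    apply: poly_overB => // [i|]; first by rewrite coef_map; exact: L_cst.
    by apply: poly_overZ => // i; rewrite coef_map; exact: L_cst.
  rewrite hornerD hornerN hornerZ !horner_cst er divfK ?subrr //.
  by rewrite tf_eq0.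
case: (ex_minnP exg) => k /asboolP[p p0 [Lp px sp]] min.
have lp0 : lead_coef p != 0 by rewrite lead_coef_eq0.
exists ((lead_coef p)^-1 *: p); split.
- by rewrite monicE lead_coefZ mulVf.
- apply: poly_overZ => //; rewrite -[X in L X]mul1r.
  by apply: subfield_div => //; [exact: subfield1|exact: Lp].
- by rewrite hornerZ px mulr0.
move=> p' Lp' p'x; rewrite size_scale ?invr_eq0 // sp ltnNge => /negP lt.
apply/eqP; apply: contra_notT lt => p'0; apply: min; apply/asboolP.
by exists p'.
Qed.

(** Write z for tf 'X. Let m be the minimal polynomial of z over L, and let
    t = u / v, in lowest terms, be a nonconstant coefficient of m. Then m divides
    u(T) - t v(T) over L. Without denominators, a primitive polynomial M(z, T)
    proportional to m divides A = u(T) v(z) - v(T) u(z). The degree of A in z is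
    at most the height of t, and the degree of M in z is at least this height
    since t is a quotient of two coefficients of M. So A / M does not depend on z,
    and it is a constant because at a root T0 of it A(z, T0) = 0 would be a linear
    relation between u and v. Hence m is proportional to u(T) - t v(T) and has its
    coefficients in C(t). If a = p(z) / q(z) is in L, the remainders p1 and q1 of
    p and q modulo m lie in C(t)[T], and p1 - a q1, which vanishes at z, is 0 by
    minimality of m: so a is in C(t). *)
Theorem luroth r : L r -> (forall c, r != cst c) ->
  exists t, [/\ L t, forall c, t != cst c & L `<=` simple_extension cst t].
Proof.
move=> Lr rc; have [m [mm Lm mx min]] := minimal_polynomial Lr rc.
have gen' y : exists n d : {poly C}, d != 0 /\ y = tf n / tf d.
  by have [n [d [d0 _ e]]] := gen y; exists n, d.
have [i ti] : exists i, forall c, m`_i != cst c.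
  apply: contrapT => no.
  have cf i : exists c, m`_i = cst c.
    apply: contrapT => nc; apply: no; exists i => c.
    by apply/eqP => e; apply: nc; exists c.
  have [cs csP] := choice cf.
  pose q := \poly_(i < size m) cs i.
  have eq : m = map_poly cst q.
    apply/polyP => i; rewrite coef_map coef_poly.
    case: ltnP => [_|le]; first exact: csP.
    by rewrite nth_default //=; rewrite polyC0 rmorph0.
  move: mx; rewrite eq horner_cst => /eqP; rewrite tf_eq0 => /eqP q0.
  by move: (monic_neq0 mm); rewrite eq q0 rmorph0 eqxx.
have Lt := Lm i; set t := m`_i in ti Lt *.
exists t; split=> //.
have [u [v [v0 co et]]] := gen t.
have fv0 : tf v != 0 by rewrite tf_eq0.
have uv_free a b : a *: u = b *: v -> a = 0 /\ b = 0.
  by apply: nonconstant_free => // c; rewrite -et.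
have u0 : u != 0.
  apply: contraTneq (ti 0) => u0; rewrite negbK et u0 (rmorph0 tf) mul0r.
  by rewrite (rmorph0 cst).
(* The polynomial u(T) - t v(T) of L[T] vanishes at z. *)
pose B := map_poly cst u - t *: map_poly cst v.
have BL : poly_over L B.
  apply: poly_overB => // [j|]; first by rewrite coef_map; exact: L_cst.
  by apply: poly_overZ => // j; rewrite coef_map; exact: L_cst.
have Bx : B.[x] = 0.
  by rewrite hornerD hornerN hornerZ !horner_cst et divfK ?subrr.
have [R LR [sR [Q0 eB]]] := poly_over_mod subL mm Lm BL.
have R0 : R = 0.
  apply: min => //; have := congr1 (horner^~ x) eB.
  rewrite hornerD hornerN hornerM mx mulr0 Bx sub0r => /eqP.
  by rewrite oppr_eq0 => /eqP.
move: eB; rewrite {LR sR}R0 subr0 => eB.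
(* M is m with its denominators cleared and its content removed. *)
have [D [M0 [D0 eM0]]] := clear_denominators m tf_inj gen'.
have M00 : M0 != 0.
  apply: contraTneq (monic_neq0 mm) => M00; move: eM0; rewrite M00 rmorph0.
  by move/eqP; rewrite scaler_eq0 tf_eq0 (negbTE D0) /= => ->.
have [c [M [c0 prM eM]]] := primitive_part M00.
pose l := M`_(size m).-1.
have Mm j : tf M`_j = tf l * m`_j.
  have h k : tf D * m`_k = tf c * tf M`_k.
    have := congr1 (fun p : {poly Z} => p`_k) eM0.
    by rewrite coefZ coef_map eM coefCM /= rmorphM.
  have hl : tf D = tf c * tf l.
    by rewrite -h -lead_coefE (monicP mm) mulr1.
  apply: (@mulfI _ (tf c)); first by rewrite tf_eq0.
  by rewrite mulrA -hl h.
have l0 : l != 0.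
  apply: contraTneq (prM 0) => l0; rewrite negbK; apply/eqP/polyP => j.
  rewrite coef_map coef0 /=; have := Mm j; rewrite l0 rmorph0 mul0r => /eqP.
  by rewrite tf_eq0 => /eqP ->; rewrite /horner_eval horner0.
have fl0 : tf l != 0 by rewrite tf_eq0.
have mM : map_poly tf M = tf l *: m.
  by apply/polyP => j; rewrite coef_map coefZ; exact: Mm.
pose A : {poly {poly C}} := v *: map_poly polyC u - u *: map_poly polyC v.
have AB : map_poly tf A = tf v *: B.
  rewrite rmorphB /= !map_polyZ -!map_poly_comp scalerBr scalerA.
  have -> : tf v * t = tf u by rewrite et mulrC divfK.
  by [].
have [D' [Q [D'0 eQ]]] := clear_denominators Q0 tf_inj gen'.
have [||Q' eA] := @primitive_dvd _ (D' * l) A M (v *: Q) _ prM.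
- by rewrite mulf_neq0.
- apply: (map_inj_poly tf_inj (rmorph0 tf)).
  have mapM X Y : map_poly tf (X * Y) = map_poly tf X * map_poly tf Y.
    exact: rmorphM.
  rewrite !mapM map_polyC map_polyZ -eQ mM AB eB mul_polyC /= rmorphM.
  rewrite -!(scalerAl, scalerAr) !scalerA.
  by congr (_ *: _); rewrite ?[m * _]mulrC //; ring.
have A0 : A != 0.
  apply/eqP => A0; have := congr1 (fun p : {poly {poly C}} => p`_(size v).-1) A0.
  rewrite coef0 coefB !coefZ !coef_map /= -lead_coefE => /subr0_eq.
  rewrite mulrC [u * _]mulrC !mul_polyC => e.
  have [/eqP + _] := uv_free _ _ (esym e).
  by rewrite lead_coef_eq0 (negbTE v0).
have M1 : M != 0 by apply: contra_neq A0 => M1; rewrite eA M1 mul0r.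
have Q'1 : Q' != 0 by apply: contra_neq A0 => Q'1; rewrite eA Q'1 mulr0.
have sA : (sizeY A <= maxn (size u) (size v))%N.
  apply/bigmax_leqP => j _; rewrite coefB !coefZ !coef_map /=.
  rewrite mulrC [u * _]mulrC !mul_polyC (leq_trans (size_polyD _ _)) //.
  by rewrite size_polyN maxnC geq_max !leq_max !size_scale_leq ?orbT.
have eMi : M`_i * v = l * u.
  by apply: tf_inj; rewrite !rmorphM /= Mm -/t et mulrA divfK.
(* As t = M_i / l = u / v in lowest terms, u divides M_i and v divides l. *)
have sM : (maxn (size u) (size v) <= sizeY M)%N.
  have Mi0 : M`_i != 0.
    apply: contraTneq (mulf_neq0 l0 u0) => Mi0.
    by rewrite -eMi Mi0 mul0r negbK.
  rewrite geq_max; apply/andP; split.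
    apply: leq_trans (max_size_coefXY M i); apply: dvdp_leq => //.
    by rewrite -(Gauss_dvdpl _ co) eMi dvdp_mull.
  apply: leq_trans (max_size_coefXY M (size m).-1); apply: dvdp_leq => //.
  by rewrite -(@Gauss_dvdpl _ _ u) 1?coprimep_sym // -eMi dvdp_mull.
have [w eQ'] : exists w, Q' = map_poly polyC w.
  exists (swapXY Q')`_0; rewrite -swapXY_polyC -size1_polyC ?swapXYK //.
  have := leq_trans sA sM; rewrite !sizeYE eA rmorphM /=.
  rewrite size_mul ?swapXY_eq0 //.
  have : (0 < size (swapXY Q'))%N by rewrite size_poly_gt0 swapXY_eq0.
  have : (0 < size (swapXY M))%N by rewrite size_poly_gt0 swapXY_eq0.
  by case: (size (swapXY M)) => // a _; rewrite addSn /= -{2}[a]addn0 -addnS leq_add2l.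
have [sw|/closed_rootP[T0 /rootP wT0]] := eqVneq (size w) 1%N; last first.
  have := congr1 (horner^~ T0%:P) eA.
  rewrite eQ' hornerM horner_map wT0 mulr0 hornerD hornerN !hornerZ !horner_map /=.
  move=> /subr0_eq; rewrite mulrC [u * _]mulrC !mul_polyC => e.
  have [vT0 /rootP uT0] := uv_free _ _ (esym e).
  by have := coprimep_root co uT0; rewrite vT0 eqxx.
have /size_poly1P[w0 w00 ew] : size w == 1%N by rewrite sw.
(* Hence m is proportional to B, whose coefficients lie in C(t). *)
have [k ek] : exists k, m = k *: B.
  exists (tf v * (tf (l * w0%:P))^-1); apply: (@scalerI _ _ (tf (l * w0%:P))).
    by rewrite tf_eq0 mulf_neq0 ?polyC_eq0.
  rewrite scalerA mulrCA divff ?tf_eq0 ?mulf_neq0 ?polyC_eq0 // mulr1 -AB.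
  have -> : A = w0%:P *: M.
    by rewrite eA eQ' ew map_polyC /= mulrC mul_polyC.
  have -> : map_poly tf (w0%:P *: M) = tf w0%:P *: map_poly tf M.
    exact: map_polyZ.
  by rewrite mM scalerA rmorphM mulrC.
pose S := simple_extension cst t.
have subS : is_subfield S := simple_extension_subfield cst t.
have Sc c' : S (cst c').
  by have := simple_extension_poly cst t c'%:P; rewrite map_polyC hornerC.
have St : S t.
  by have := simple_extension_poly cst t 'X; rewrite map_polyX hornerX.
have SB : poly_over S B.
  apply: poly_overB => // [j|]; first by rewrite coef_map; exact: Sc.
  by apply: poly_overZ => // j; rewrite coef_map; exact: Sc.
have Sm : poly_over S m.
  have e1 : 1 = k * B`_(size m).-1.
    by rewrite -(monicP mm) lead_coefE {1}ek coefZ.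
  have k0 : k != 0 by apply: contra_eq_neq e1 => ->; rewrite mul0r oner_neq0.
  move=> j; rewrite ek coefZ.
  have -> : k = 1 / B`_(size m).-1.
    by rewrite e1 mulfK //; apply: contra_eq_neq e1 => ->; rewrite mulr0 oner_neq0.
  apply: subfieldM => //; apply: subfield_div => //; exact: subfield1.
have SL : S `<=` L by apply: sub_simple_extension.
move=> a La; have [n [d [d0 _ ea]]] := gen a.
have Sp p : poly_over S (map_poly cst p).
  by move=> j; rewrite coef_map; exact: Sc.
have [n1 Sn [sn [qn en]]] := poly_over_mod subS mm Sm (Sp n).
have [d1 Sd [sd [qd ed]]] := poly_over_mod subS mm Sm (Sp d).
have n1x : n1.[x] = tf n.
  have := congr1 (horner^~ x) en; rewrite hornerD hornerN hornerM mx mulr0.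
  by rewrite horner_cst => /subr0_eq.
have d1x : d1.[x] = tf d.
  have := congr1 (horner^~ x) ed; rewrite hornerD hornerN hornerM mx mulr0.
  by rewrite horner_cst => /subr0_eq.
have fd0 : tf d != 0 by rewrite tf_eq0.
have d10 : d1 != 0 by apply: contra_neq fd0 => d10; rewrite -d1x d10 horner0.
have : n1 - a *: d1 = 0.
  apply: min.
  - apply: poly_overB => // [j|]; first exact/SL/Sn.
    by apply: poly_overZ => // j; exact/SL/Sd.
  - by rewrite hornerD hornerN hornerZ n1x d1x ea divfK // subrr.
  rewrite (leq_ltn_trans (size_polyD _ _)) // size_polyN gtn_max sn /=.
  exact: leq_ltn_trans (size_scale_leq _ _) sd.
move=> /subr0_eq/(congr1 (fun p : {poly Z} => p`_(size d1).-1)).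
rewrite coefZ -lead_coefE => e1.
have -> : a = n1`_(size d1).-1 / lead_coef d1 by rewrite e1 mulfK ?lead_coef_eq0.
by apply: (subfield_div subS); [exact: Sn|exact: Sd].
Qed.

End Luroth.

(** * Complex derivatives *)

Section Derivatives.
Variable K : numFieldType.
Implicit Types (f g : K -> K) (U V : set K) (x : K).

Lemma derive1_near f g x : (\forall y \near x, f y = g y) ->
  derivable f x 1 -> derivable g x 1 /\ derive1 g x = derive1 f x.
Proof.
move=> fg df; split; first exact: near_eq_derivable fg df.
by rewrite !derive1E (near_eq_derive _ fg).
Qed.

Lemma derivable1_continuous f x : derivable f x 1 -> {for x, continuous f}.
Proof. by move/derivable1_diffP/differentiable_continuous. Qed.

Lemma derive1M f g x : derivable f x 1 -> derivable g x 1 ->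
  derivable (f \* g) x 1 /\
  derive1 (f \* g) x = derive1 f x * g x + f x * derive1 g x.
Proof.
move=> df dg; split; first exact: derivableM.
by rewrite !derive1E deriveM // addrC; congr (_ + _); rewrite mulrC.
Qed.

Lemma derive1D f g x : derivable f x 1 -> derivable g x 1 ->
  derivable (f \+ g) x 1 /\ derive1 (f \+ g) x = derive1 f x + derive1 g x.
Proof. by move=> df dg; split; [exact: derivableD|rewrite !derive1E deriveD]. Qed.

Lemma derive1V f x : derivable f x 1 -> f x != 0 ->
  derivable (fun y => (f y)^-1) x 1 /\
  derive1 (fun y => (f y)^-1) x = - derive1 f x * ((f x)^-1 * (f x)^-1).
Proof.
move=> df f0; split; first exact: derivableV.
rewrite !derive1E deriveV // scaleNr mulNr; congr (- _).
by rewrite mulrC -expr2 exprVn.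
Qed.

Lemma derive1_chain f g x : derivable f x 1 -> derivable g (f x) 1 ->
  derivable (g \o f) x 1 /\ derive1 (g \o f) x = derive1 g (f x) * derive1 f x.
Proof.
move=> df dg.
have df' : differentiable f x by apply/derivable1_diffP.
have dg' : differentiable g (f x) by apply/derivable1_diffP.
have dgf : differentiable (g \o f) x by exact: differentiable_comp.
split; first exact/derivable1_diffP.
apply: (etrans (derive1E' dgf)).
apply: (etrans (congr1 (fun h : K -> K => h 1) (diff_comp df' dg'))).
apply: (etrans (congr1 (fun h : K -> K => h ('d f x 1)) (deriv1E dg))).
by rewrite -(derive1E' df') mulrC.
Qed.

Lemma derive1_horner (p : {poly K}) x :
  derivable (horner p) x 1 /\ derive1 (horner p) x = p^`().[x].
Proof.
elim/poly_ind: p => [|p c [dp e]].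
  have -> : horner 0 = cst 0 :> (K -> K) by apply/funext => y; rewrite horner0.
  split; first exact: derivable_cst.
  by rewrite derive1_cst deriv0 horner0.
have -> : horner (p * 'X + c%:P) = (horner p \* id) \+ cst c.
  by apply/funext => y; rewrite /= !hornerE.
have [d1 e1] := derive1M dp (@derivable_id _ _ x 1).
have [d2 e2] := derive1D d1 (@derivable_cst _ _ _ c x 1).
split=> //; rewrite e2 e1 e derive1_cst addr0 derivD derivC addr0 derivM derivX.
by rewrite !hornerE derive1E derive_id mulr1.
Qed.

(** The index is shifted: [smooth 0 U f] says that f is differentiable on U. *)
Fixpoint smooth n U f : Prop :=
  (forall x, U x -> derivable f x 1) /\
  (if n is n'.+1 then smooth n' U (derive1 f) else True).

Lemma smooth_derivable n U f x : smooth n U f -> U x -> derivable f x 1.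
Proof. by case: n => [|n] [+ _] => /[apply]. Qed.

Lemma smoothW n U f : smooth n.+1 U f -> smooth n U f.
Proof.
elim: n f => [|n IH] f [df sf]; first by split.
by split=> //; apply: IH.
Qed.

Lemma smooth_sub n U V f : V `<=` U -> smooth n U f -> smooth n V f.
Proof.
move=> VU; elim: n f => [|n IH] f [df sf].
  by split=> // x /VU; exact: df.
by split; [move=> x /VU; exact: df|exact: IH].
Qed.

Lemma smooth_iter U f :
  (forall n, smooth n U f) <->
  (forall n x, U x -> derivable (derive1n n f) x 1).
Proof.
split=> [sf n|df n].
  elim: n f sf => [|n IH] f sf x Ux; first exact: smooth_derivable (sf 0%N) Ux.
  rewrite derive1Sn; apply: IH => // n'; by have [] := sf n'.+1.
elim: n f df => [|n IH] f df; first by split=> // x; apply: (df 0%N).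
split; first exact: (df 0%N).
by apply: IH => n' x Ux; rewrite -derive1Sn; exact: df.
Qed.

Section OnOpen.
Variable U : set K.
Hypothesis oU : open U.

Lemma smooth_ext n f g : (forall x, U x -> f x = g x) ->
  smooth n U f -> smooth n U g.
Proof.
have near (h h' : K -> K) x : (forall x, U x -> h x = h' x) -> U x ->
    \forall y \near x, h y = h' y.
  move=> e Ux; have : nbhs x U by apply: open_nbhs_nbhs; split.
  by apply: filterS => y /e.
elim: n f g => [|n IH] f g e [df sf].
  split=> [x Ux|//]; exact: (proj1 (derive1_near (near _ _ _ e Ux) (df x Ux))).
split; first by move=> x Ux; exact: (proj1 (derive1_near (near _ _ _ e Ux) (df x Ux))).
apply: IH sf => x Ux.
by have [_ ->] := derive1_near (near _ _ _ e Ux) (df x Ux).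
Qed.

Lemma smooth_cst n c : smooth n U (cst c).
Proof.
elim: n c => [|n IH] c; first by split=> // x _; exact: derivable_cst.
split=> [x _|]; first exact: derivable_cst.
by apply: smooth_ext (IH 0) => x _; rewrite derive1_cst.
Qed.

Lemma smooth_id n : smooth n U id.
Proof.
case: n => [|n]; first by split=> // x _; exact: derivable_id.
split=> [x _|]; first exact: derivable_id.
by apply: smooth_ext (smooth_cst n 1) => x _; rewrite derive1E derive_id.
Qed.

Lemma smoothD n f g : smooth n U f -> smooth n U g -> smooth n U (f \+ g).
Proof.
elim: n f g => [|n IH] f g [df sf] [dg sg].
  split=> [x Ux|//]; exact: (proj1 (derive1D (df x Ux) (dg x Ux))).
split; first by move=> x Ux; exact: (proj1 (derive1D (df x Ux) (dg x Ux))).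
apply: smooth_ext (IH _ _ sf sg) => x Ux.
by have [_ ->] := derive1D (df x Ux) (dg x Ux).
Qed.

Lemma smoothM n f g : smooth n U f -> smooth n U g -> smooth n U (f \* g).
Proof.
elim: n f g => [|n IH] f g Sf Sg.
  have [df _] := Sf; have [dg _] := Sg.
  split=> [x Ux|//]; exact: (proj1 (derive1M (df x Ux) (dg x Ux))).
have [df sf] := Sf; have [dg sg] := Sg.
split; first by move=> x Ux; exact: (proj1 (derive1M (df x Ux) (dg x Ux))).
apply: smooth_ext (smoothD (IH _ _ sf (smoothW Sg)) (IH _ _ (smoothW Sf) sg)).
by move=> x Ux; have [_ ->] := derive1M (df x Ux) (dg x Ux).
Qed.

Lemma smoothV n f : (forall x, U x -> f x != 0) ->
  smooth n U f -> smooth n U (fun x => (f x)^-1).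
Proof.
move=> f0; elim: n => [|n IH] Sf; have [df sf] := Sf.
  split=> [x Ux|//]; exact: (proj1 (derive1V (df x Ux) (f0 x Ux))).
split; first by move=> x Ux; exact: (proj1 (derive1V (df x Ux) (f0 x Ux))).
have sV := IH (smoothW Sf).
apply: smooth_ext (smoothM (smoothM (smooth_cst n (-1)) sf) (smoothM sV sV)).
by move=> x Ux; have [_ ->] := derive1V (df x Ux) (f0 x Ux); rewrite /= mulN1r.
Qed.

Lemma smooth_comp n V f g : (forall x, U x -> V (f x)) ->
  smooth n U f -> smooth n V g -> smooth n U (g \o f).
Proof.
move=> UV; elim: n g => [|n IH] g Sf [dg sg].
  have [df _] := Sf.
  split=> [x Ux|//]; exact: (proj1 (derive1_chain (df x Ux) (dg _ (UV x Ux)))).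
have [df sf] := Sf.
split; first by move=> x Ux; exact: (proj1 (derive1_chain (df x Ux) (dg _ (UV x Ux)))).
apply: smooth_ext (smoothM (IH _ (smoothW Sf) sg) sf) => x Ux.
by have [_ ->] := derive1_chain (df x Ux) (dg _ (UV x Ux)).
Qed.

Lemma smooth_sum n (I : Type) (r : seq I) (h : I -> K -> K) :
  (forall i, smooth n U (h i)) -> smooth n U (fun x => \sum_(i <- r) h i x).
Proof.
move=> sh; elim: r => [|i r IH].
  by apply: smooth_ext (smooth_cst n 0) => x _; rewrite big_nil.
by apply: smooth_ext (smoothD (sh i) IH) => x _; rewrite big_cons.
Qed.

Lemma smooth_prod n (I : Type) (r : seq I) (h : I -> K -> K) :
  (forall i, smooth n U (h i)) -> smooth n U (fun x => \prod_(i <- r) h i x).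
Proof.
move=> sh; elim: r => [|i r IH].
  by apply: smooth_ext (smooth_cst n 1) => x _; rewrite big_nil.
by apply: smooth_ext (smoothM (sh i) IH) => x _; rewrite big_cons.
Qed.

Lemma smooth_meval n m (h : K -> 'I_m -> K) (P : mpoly m K) :
  (forall i, smooth n U (h^~ i)) -> smooth n U (fun x => meval (h x) P).
Proof.
move=> sh; apply: smooth_sum => mu.
apply: (smoothM (smooth_cst n (mcoeff mu P))); apply: smooth_prod => i.
elim: (mu i) => [|k IH]; first exact: (smooth_cst n 1).
apply: smooth_ext (smoothM (sh i) IH) => x _.
by rewrite /= exprS.
Qed.

End OnOpen.
End Derivatives.

(** * Values of rational functions outside finite sets *)

Section Cofinite.
Variable T : Type.
Implicit Types P Q : T -> Prop.

Definition cofinite P := finite_set [set z | ~ P z].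

Lemma cofiniteW P Q : (forall z, P z -> Q z) -> cofinite P -> cofinite Q.
Proof. by move=> PQ; apply: sub_finite_set => z /= nQ /PQ. Qed.

Lemma cofinite_all P : (forall z, P z) -> cofinite P.
Proof. by move=> aP; apply: sub_finite_set (@finite_set0 T) => z /=; apply. Qed.

Lemma cofiniteI P Q : cofinite P -> cofinite Q ->
  cofinite (fun z => P z /\ Q z).
Proof.
move=> fP fQ; have : finite_set ([set z | ~ P z] `|` [set z | ~ Q z]).
  by rewrite finite_setU.
by apply: sub_finite_set => z /= /not_andP.
Qed.

Lemma cofinite_forall_seq (I : eqType) (s : seq I) (P : I -> T -> Prop) :
  (forall i, i \in s -> cofinite (P i)) ->
  cofinite (fun z => forall i, i \in s -> P i z).
Proof.
elim: s => [|i s IH] cP; first exact: cofinite_all.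
have h := cofiniteI (cP i (mem_head _ _))
  (IH (fun j js => cP j (mem_behead (s := i :: s) js))).
apply: cofiniteW h => z [Pi Ps] j; rewrite inE => /orP[/eqP ->|/Ps] //.
Qed.

Lemma cofinite_forall (I : finType) (P : I -> T -> Prop) :
  (forall i, cofinite (P i)) -> cofinite (fun z => forall i, P i z).
Proof.
move=> cP; have := @cofinite_forall_seq _ (enum I) P (fun i _ => cP i).
by apply: cofiniteW => z Pz i; apply: Pz; rewrite mem_enum.
Qed.

End Cofinite.

Section CofiniteNear.
Variable K : numFieldType.

Lemma cofinite_near (P : K -> Prop) z : cofinite P -> P z ->
  \forall y \near z, P y.
Proof.
move=> cP Pz; have cl : closed [set z | ~ P z].
  have /accessible_finite_set_closed h := hausdorff_accessible (@norm_hausdorff _ K).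
  exact: h.
have : open_nbhs z (~` [set z | ~ P z]) by split; [exact: closed_openC|move=> /=].
by move=> /open_nbhs_nbhs; apply: filterS => y /= /contrapT.
Qed.

Lemma cofinite_dnbhs (P : K -> Prop) z : cofinite P ->
  \forall y \near z^', P y.
Proof.
move=> cP; have := @cofinite_near (fun y => y <> z -> P y) z.
rewrite /dnbhs /within /= => h.
have : \forall y \near z, y <> z -> P y.
  by apply: h => //; apply: cofiniteW cP.
by apply: filterS => y Py /eqP.
Qed.

Lemma open_cofinite (U : set K) (P : K -> Prop) z :
  open U -> U z -> cofinite P -> exists y, U y /\ P y.
Proof.
move=> oU Uz cP.
have nU : \forall y \near z^', U y.
  by apply: nbhs_dnbhs; apply: open_nbhs_nbhs.
have [y [Uy Py]] := @filter_ex _ _ _ _ (filterI nU (cofinite_dnbhs z cP)).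
by exists y.
Qed.

End CofiniteNear.

Section RationalValues.
Variable C : numClosedFieldType.
Local Notation Z := {fraction {poly C}}.
Implicit Types (f g : Z) (F G : C -> C) (z v w : C) (p : {poly C}).

Lemma rat_valueE f z v :
  rat_value f z v <-> fraction_value (@tofrac {poly C}) (horner_eval z) f v.
Proof.
split=> [[n [d [-> d0 ->]]]|[n [d [_ -> d0 ->]]]]; exists n, d; split=> //.
by rewrite tofrac_eq0; apply: contra_neq d0 => ->; rewrite horner0.
Qed.

Lemma tofrac_horner0 z p : @tofrac {poly C} p = 0 -> horner_eval z p = 0.
Proof. by move=> /eqP; rewrite tofrac_eq0 => /eqP ->; rewrite rmorph0. Qed.

Lemma rat_value_uniq f z v w : rat_value f z v -> rat_value f z w -> v = w.
Proof.
by rewrite !rat_valueE; apply: fraction_value_uniq; exact: tofrac_horner0.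
Qed.

Lemma rat_value_base p z : rat_value (tofrac p) z p.[z].
Proof. by rewrite rat_valueE; exact: fraction_value_base. Qed.

Lemma rat_valueD f g z v w :
  rat_value f z v -> rat_value g z w -> rat_value (f + g) z (v + w).
Proof. by rewrite !rat_valueE; exact: fraction_valueD. Qed.

Lemma rat_valueM f g z v w :
  rat_value f z v -> rat_value g z w -> rat_value (f * g) z (v * w).
Proof. by rewrite !rat_valueE; exact: fraction_valueM. Qed.

Lemma rat_value_div f g z v w :
  rat_value f z v -> rat_value g z w -> w != 0 -> rat_value (f / g) z (v / w).
Proof.
by rewrite !rat_valueE; apply: fraction_value_div; exact: tofrac_horner0.
Qed.

Lemma rat_value_cst c z : rat_value (cfrac C c) z c.
Proof. by have := rat_value_base c%:P z; rewrite hornerC. Qed.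

Lemma rat_funE f z v : rat_value f z v -> rat_fun f z = v.
Proof.
by move=> fv; apply: xget_unique => // w fw; exact: (rat_value_uniq fw fv).
Qed.

Lemma finite_roots p : p != 0 -> cofinite (fun z => p.[z] != 0).
Proof.
have [r ->] := closed_field_poly_normal p; rewrite scaler_eq0 negb_or => /andP[c0 _].
apply: (sub_finite_set _ (finite_seq r)) => z /= /negP; rewrite negbK hornerZ.
rewrite mulf_eq0 (negbTE c0) /= horner_prod prodf_seq_eq0 => /hasP[y yr] /=.
by rewrite hornerXsubC subr_eq0 => /eqP ->.
Qed.

Lemma cofinite_regular f : cofinite (fun z => exists v, rat_value f z v).
Proof.
have [n [d [d0 ->]]] := fraction_quotient f.
by apply: cofiniteW (finite_roots d0) => z dz; exists (n.[z] / d.[z]), n, d.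
Qed.

Lemma cofinite_neq0 f : f != 0 ->
  cofinite (fun z => forall v, rat_value f z v -> v != 0).
Proof.
have [n [d [d0 ->]]] := fraction_quotient f.
rewrite mulf_eq0 invr_eq0 !tofrac_eq0 negb_or => /andP[n0 _].
apply: cofiniteW (cofiniteI (finite_roots d0) (finite_roots n0)) => z [dz nz] v.
have h : rat_value (tofrac n / tofrac d) z (n.[z] / d.[z]) by exists n, d.
by move=> /(rat_value_uniq h) <-; rewrite mulf_neq0 ?invr_eq0.
Qed.

Definition almost_rational F f := cofinite (fun z => rat_value f z (F z)).

Lemma almost_rational_div F G f g : g != 0 ->
  almost_rational F f -> almost_rational G g ->
  almost_rational (fun z => F z / G z) (f / g).
Proof.
move=> g0 rF rG.
apply: cofiniteW (cofiniteI (cofiniteI rF rG) (cofinite_neq0 g0)) => z [[fF gG] h].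
exact: rat_value_div (h _ gG).
Qed.

Lemma deriv_eq0 p : p^`() = 0 -> exists c, p = c%:P.
Proof.
move=> p0; exists p`_0; apply/polyP => -[|i]; rewrite coefC //=.
have /eqP := congr1 (fun p : {poly C} => p`_i) p0.
by rewrite coef_deriv coef0 mulrn_eq0 => /eqP.
Qed.

(** If n / d is in lowest terms and has derivative 0, then n' d = n d', so d
    divides d', which has a smaller degree: d is constant, and then n is. *)
Lemma almost_rational_derive1 F f : almost_rational F f ->
  exists f', [/\ almost_rational (derive1 F) f',
    cofinite (fun z => derivable F z 1) & f' = 0 -> exists c, f = cfrac C c].
Proof.
move=> rF; have [n [d [d0 co ef]]] := fraction_coprime f.
exists (tofrac (n^`() * d - n * d^`()) / tofrac (d * d)).
have good : cofinite (fun z => d.[z] != 0 /\ F z = n.[z] / d.[z]).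
  apply: cofiniteW (cofiniteI rF (finite_roots d0)) => z [fF dz]; split=> //.
  by apply: (rat_value_uniq fF); exists n, d.
have dF z : d.[z] != 0 /\ F z = n.[z] / d.[z] -> derivable F z 1 /\
    derive1 F z = (n^`() * d - n * d^`()).[z] / (d * d).[z].
  move=> gz; have [dz _] := gz.
  have near : \forall y \near z, (horner n \* (fun y => (d.[y])^-1)) y = F y.
    by apply: filterS (cofinite_near good gz) => y [_ ->].
  have [dn en] := derive1_horner n z; have [dd ed] := derive1_horner d z.
  have [dv ev] := derive1V dd dz.
  have [dm em] := derive1M dn dv.
  have [dF eF] := derive1_near near dm.
  split=> //; rewrite eF em ev en ed hornerD hornerN !hornerM.
  by field; rewrite dz.
split.
- apply: cofiniteW good => z gz; have [dz _] := gz; have [_ ->] := dF z gz.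
  by exists (n^`() * d - n * d^`()), (d * d); rewrite hornerM mulf_neq0.
- by apply: cofiniteW good => z /dF[].
move=> /eqP; rewrite mulf_eq0 invr_eq0 !tofrac_eq0 mulf_eq0 orbb (negbTE d0) orbF.
rewrite subr_eq0 => /eqP e.
have dd : d %| d^`().
  by rewrite -(@Gauss_dvdpr _ _ n d) 1?coprimep_sym // -e dvdp_mull.
have d'0 : d^`() = 0.
  apply/eqP; apply: contraT => d'0; have := dvdp_leq d'0 dd.
  by rewrite leqNgt lt_size_deriv.
have [a ea] := deriv_eq0 d'0.
have n'0 : n^`() = 0.
  by apply/eqP; move/eqP: e; rewrite d'0 mulr0 mulf_eq0 (negbTE d0) orbF.
have [b eb] := deriv_eq0 n'0.
by exists (b / a); rewrite ef ea eb fmorph_div.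
Qed.

End RationalValues.

(** * Ideals of parametrized varieties *)

Section Parametrizations.
Variables (C : numClosedFieldType) (n : nat).
Local Notation Z := {fraction {poly C}}.
Implicit Types (q : 'I_n -> Z) (P : mpoly n C) (S : set ('I_n -> C)).

Definition param_eval q : {rmorphism mpoly n C -> Z} := mmap (cfrac C) q.

Lemma param_value_eval q z p P : param_value q z p ->
  rat_value (param_eval q P) z (meval p P).
Proof.
move=> qp; rewrite rat_valueE; apply: fraction_value_mmap => [mu _|i].
  by rewrite -rat_valueE; exact: rat_value_cst.
by rewrite -rat_valueE.
Qed.

Arguments param_value_eval {q z p} P _.

Lemma cofinite_param q : cofinite (fun z => exists p, param_value q z p).
Proof.
apply: cofiniteW (cofinite_forall (fun i => cofinite_regular (q i))) => z h.
by have [p pP] := choice h; exists p.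
Qed.

Lemma param_image_vanish q P :
  (forall p, param_image q p -> meval p P = 0) <-> param_eval q P = 0.
Proof.
split=> [van|P0 p [z /(param_value_eval P)]]; last first.
  by rewrite P0 => /rat_value_uniq; apply; have := rat_value_cst 0 z; rewrite rmorph0.
apply/eqP; apply: contraT => /cofinite_neq0 c1.
have [z [_ [h [p qp]]]] :=
  open_cofinite openT (I : setT (0 : C)) (cofiniteI c1 (cofinite_param q)).
have := h _ (param_value_eval P qp); rewrite van ?eqxx //.
by exists z.
Qed.

Lemma closure_vanish S P :
  (forall p, zariski_closure S p -> meval p P = 0) <->
  (forall p, S p -> meval p P = 0).
Proof.
split=> [h p Sp|h p]; last exact.
by apply: h => P' h'; exact: h'.
Qed.

(** A polynomial vanishes on the image of q if and only if P(q) = 0 in C(z),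
    because a nonzero rational function has finitely many zeros. So the inclusion
    of the image and its density are the two halves of an equality of ideals. *)
Lemma parametrization_ideal S q :
  rational_parametrization (zariski_closure S) q <->
  (forall P, (forall p, S p -> meval p P = 0) <-> param_eval q P = 0).
Proof.
split=> [[sub dom] P|ker].
  rewrite -param_image_vanish -closure_vanish.
  split=> h p; first by move=> /sub /h.
  by move=> /dom; apply.
split=> p; first by move=> qp P /ker/param_image_vanish; apply.
by move=> cp P /param_image_vanish/ker; apply: cp.
Qed.

Section Inverse.
Variables (S : set ('I_n -> C)) (q : 'I_n -> Z).
Hypothesis par : rational_parametrization (zariski_closure S) q.

Lemma ideal_vanish p P : zariski_closure S p -> param_eval q P = 0 ->
  meval p P = 0.
Proof. by move=> Vp; have /parametrization_ideal ker := par; move/ker/Vp. Qed.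

Lemma inverse_relation hN hE :
  inverse_parametrization (zariski_closure S) q hN hE ->
  param_eval q hE != 0 /\
  param_eval q hN = tofrac 'X * param_eval q hE.
Proof.
move=> [[p Vp hEp] inv _].
have E0 : param_eval q hE != 0.
  by apply: contra_neq hEp; exact: ideal_vanish.
split=> //; apply/subr0_eq/eqP; apply: contraT => /cofinite_neq0 c1.
have [z [_ [h [h' [p' qp']]]]] := open_cofinite openT (I : setT (0 : C))
  (cofiniteI c1 (cofiniteI (cofinite_neq0 E0) (cofinite_param q))).
have hN' := param_value_eval hN qp'; have hE' := param_value_eval hE qp'.
have X : rat_value (tofrac 'X) z z by have := rat_value_base 'X z; rewrite hornerX.
have := rat_valueD hN' (rat_valueM (rat_value_cst (-1) z) (rat_valueM X hE')).
rewrite rmorphN1 !mulN1r => /h; have E0z := h' _ hE'.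
by rewrite -(inv z p' qp' E0z) divfK // subrr eqxx.
Qed.

(** For the last condition, a point p of the variety with hE(p) /= 0 gives a
    value to the rational function z = hN(q) / hE(q), namely h(p), hence to each
    coordinate of q, namely q(h(p)). This value is also the coordinate of p. *)
Lemma relation_inverse hN hE : param_eval q hE != 0 ->
  param_eval q hN = tofrac 'X * param_eval q hE ->
  inverse_parametrization (zariski_closure S) q hN hE.
Proof.
move=> E0 eN; split.
- have [z [_ [h [p qp]]]] := open_cofinite openT (I : setT (0 : C))
    (cofiniteI (cofinite_neq0 E0) (cofinite_param q)).
  exists p; last exact: h _ (param_value_eval hE qp).
  by have [sub _] := par; apply: sub; exists z.
- move=> z p qp E0p.
  have hN' := param_value_eval hN qp; have hE' := param_value_eval hE qp.
  have X : rat_value (tofrac 'X) z z.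
    by have := rat_value_base 'X z; rewrite hornerX.
  have := rat_valueM X hE'; rewrite -eN => /(rat_value_uniq hN') ->.
  by rewrite mulfK.
move=> p p' Vp E0p qp'.
have sub P : param_eval q P = 0 -> meval p P = 0 by exact: ideal_vanish.
pose c := meval p hN / meval p hE; rewrite -/c in qp'.
(* The value of z at p is h(p), so the value of u(z) is u(h(p)). *)
have val (u : {poly C}) :
    fraction_value (param_eval q) (meval p) (tofrac u) u.[c].
  elim/poly_ind: u => [|u a IH].
    rewrite rmorph0 horner0.
    by have := fraction_value_base (param_eval q) (meval p) 0; rewrite !rmorph0.
  rewrite rmorphD rmorphM /= hornerMXaddC; apply: fraction_valueD.
    apply: fraction_valueM => //.
    by exists hN, hE; split=> //; rewrite eN mulfK.
  have := fraction_value_base (param_eval q) (meval p) (mpolyC n a).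
  by rewrite /param_eval /= mmapC mevalC.
apply/funext => i; apply: (fraction_value_uniq sub) (_ : _ (q i) _) _.
  have [u [d [-> d0 ->]]] := qp' i.
  exact: fraction_value_div.
have := fraction_value_base (param_eval q) (meval p) (mpolyX C (mnm1 i)).
by rewrite /param_eval /= mmapX mmap1U mevalXU.
Qed.

End Inverse.
End Parametrizations.

(** * Algebra of radical towers *)

Lemma pcons0 (T : Type) n (x : T) (v : 'I_n -> T) : pcons x v ord0 = x.
Proof. by rewrite /pcons unlift_none. Qed.

Lemma pconsS (T : Type) n (x : T) (v : 'I_n -> T) i :
  pcons x v (lift ord0 i) = v i.
Proof. by rewrite /pcons liftK. Qed.

Section TowerAlgebra.
Variables (k K : fieldType) (iota : {rmorphism {fraction {poly k}} -> K}).
Variables (m : nat) (Fi : nat -> set K) (delta : 'I_m -> K) (e : 'I_m -> nat).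
Hypothesis tower : radical_tower iota Fi delta e.

Lemma tower_ind (S : set K) : is_subfield S -> (forall f, S (iota f)) ->
  (forall i, S (delta i ^+ e i) -> S (delta i)) -> forall a, S a.
Proof.
move=> subS Siota Srad.
have SF i : (i <= m)%N -> Fi i `<=` S.
  elim: i => [_|i IH im]; first by rewrite (tower_base tower) => _ [f _ <-].
  have sFS := IH (ltnW im).
  rewrite (tower_step tower (Ordinal im)); apply: smallest_sub => //.
  by move=> _ [/sFS|->] //; apply/Srad/sFS/(tower_rad tower (Ordinal im)).
by move=> a; apply: (SF m) => //; rewrite (tower_top tower).
Qed.

Lemma tower_algebraic a : algebraicOver iota a.
Proof.
apply: (tower_ind (S := algebraicOver iota)) => {a} [|f|i [p p0 rp]].
- split; first exact: algebraic1.
  + by move=> x y; exact: algebraic_sub.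
  + by move=> x y; exact: algebraic_div.
- exact: algebraic_id.
exists (p \Po 'X^(e i)).
  apply/eqP => pX0; have := size_comp_poly p 'X^(e i).
  rewrite pX0 size_poly0 size_polyXn /= => /esym/eqP; rewrite muln_eq0.
  rewrite [e i == _]gtn_eqF ?(tower_exp tower) // orbF => /eqP sp.
  have [c pc] : exists c, p = c%:P.
    by exists p`_0; apply: size1_polyC; case: (size p) sp => // -[].
  by move: pX0 p0; rewrite pc comp_polyC => ->; rewrite eqxx.
by rewrite map_comp_poly map_polyXn root_comp hornerXn.
Qed.

Definition univariate : {rmorphism {poly k} -> mpoly m.+1 k} :=
  (horner_eval (mpolyX k (mnm1 (@ord0 m))) \o map_poly (@mpolyC m.+1 k))%FUN.

(** Convertible to [tower_eval], with the structure of a ring morphism. *)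
Definition tower_hom : {rmorphism mpoly m.+1 k -> K} :=
  mmap (iota \o cfrac k)%FUN (pcons (iota (tofrac 'X)) delta).

Lemma tower_homC c : tower_hom (mpolyC m.+1 c) = iota (cfrac k c).
Proof. by rewrite /tower_hom /= mmapC. Qed.

Lemma tower_homX i : tower_hom (mpolyX k (mnm1 i)) = pcons (iota (tofrac 'X)) delta i.
Proof. by rewrite /tower_hom /= mmapX mmap1U. Qed.

Lemma tower_hom_univariate u : tower_hom (univariate u) = iota (tofrac u).
Proof.
elim/poly_ind: u => [|u c IH]; first by rewrite !rmorph0.
rewrite rmorphD [univariate _]rmorphM /univariate /= map_polyX map_polyC /=.
rewrite !/(horner_eval _ _) hornerX hornerC !rmorphD !rmorphM /=.
by rewrite -IH mmapX mmap1U pcons0 mmapC.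
Qed.

Lemma meval_univariate (p : 'I_m.+1 -> k) u :
  meval p (univariate u) = u.[p ord0].
Proof.
elim/poly_ind: u => [|u c IH]; first by rewrite !rmorph0 horner0.
rewrite rmorphD [univariate _]rmorphM /univariate /= map_polyX map_polyC /=.
rewrite !/(horner_eval _ _) hornerX hornerC rmorphD rmorphM /=.
by rewrite hornerMXaddC -IH mevalXU mevalC.
Qed.

Lemma tower_generated a : exists N E, tower_hom E != 0 /\
  a = tower_hom N / tower_hom E.
Proof.
pose S := [set a | exists N E, tower_hom E != 0 /\
  a = tower_hom N / tower_hom E].
apply: (tower_ind (S := S)) => {a} [|f|i _].
- exact: quotients_subfield.
- have [n [d [d0 ->]]] := fraction_quotient f.
  exists (univariate n), (univariate d); rewrite !tower_hom_univariate.
  by rewrite fmorph_eq0 tofrac_eq0 fmorph_div.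
exists (mpolyX k (mnm1 (lift ord0 i))), 1.
by rewrite tower_homX rmorph1 divr1 oner_neq0 pconsS.
Qed.

(** An algebraic equation of P over C[x], divided by the largest possible power
    of the unknown, has a nonzero constant coefficient c, and c is a multiple of
    P. Since P(x, delta(x)) = 0 implies c(x) = 0, this bounds the zeros on a
    branch by algebra only, in place of the identity theorem for holomorphic
    functions. *)
Lemma tower_divides_univariate P : tower_hom P != 0 ->
  exists (c : {poly k}) (G : mpoly m.+1 k),
    c != 0 /\ tower_hom (univariate c) = tower_hom (P * G).
Proof.
set a := tower_hom P => a0; have [p p0 rp] := tower_algebraic a.
have [j [q]] := multiplicity_XsubC p 0; rewrite p0 /= => q0 ep.
have rq : root (map_poly iota q) a.
  move: rp; rewrite ep rmorphM rootM => /orP[//|].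
  rewrite subr0 rmorphXn /= map_polyX /root hornerXn expf_eq0.
  by rewrite (negbTE a0) andbF.
have inj : injective (@tofrac {poly k}).
  by move=> u v /eqP; rewrite tofrac_eq => /eqP.
have [D [Q [D0 eQ]]] := clear_denominators q inj (@fraction_quotient {poly k}).
have eQ0 : tofrac D * q`_0 = tofrac Q`_0 by rewrite -coefZ eQ coef_map.
have Q0 : Q`_0 != 0.
  apply: contraNneq q0 => Q00; move/eqP: eQ0; rewrite Q00 tofrac0 mulf_eq0.
  by rewrite tofrac_eq0 (negbTE D0) /= rootE horner_coef0.
pose tQ : {poly {poly k}} := \poly_(i < (size Q).-1) Q`_i.+1.
have QE : Q = tQ * 'X + (Q`_0)%:P.
  apply/polyP => i; rewrite coefD coefMX coefC; case: i => [|i] /=.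
    by rewrite add0r.
  rewrite addr0 coef_poly; case: ltnP => // le_i; rewrite nth_default //.
  by rewrite (leq_trans (leqSpred _)).
exists Q`_0, (- (map_poly univariate tQ).[P]); split=> //.
have Qa : (map_poly iota (map_poly (@tofrac {poly k}) Q)).[a] = 0.
  by rewrite -eQ map_polyZ hornerZ (rootP rq) mulr0.
rewrite mulrN rmorphN rmorphM tower_hom_univariate -horner_map -map_poly_comp.
apply/eqP; rewrite -addr_eq0 -[X in _ == X]Qa.
rewrite {2}QE !rmorphD !rmorphM /= !map_polyX !map_polyC /= hornerMXaddC.
rewrite -map_poly_comp addrC [a * _]mulrC; apply/eqP; congr (_ * _ + _).
congr (_.[_]); apply: eq_map_poly => u /=; exact: tower_hom_univariate.
Qed.
End TowerAlgebra.

(** * Branches and the transformed equation *)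

Section ChainCoefficients.
Variable R : realType.
Local Notation C := (Cx R).
Local Notation Z := {fraction {poly C}}.

Lemma chain_coef_gt (r : C -> C) j i : (j < i)%N -> chain_coef r j i = cst 0.
Proof.
elim: j i => [|j IH] [|i] //= ji.
by apply/funext => z; rewrite IH ?(ltnW ji) // derive1_cst IH // add0r mul0r.
Qed.

Lemma chain_coef_rational (r : C -> C) (f : Z) j i :
  almost_rational r f -> (forall c, f != cfrac C c) ->
  exists g, almost_rational (chain_coef r j i) g.
Proof.
move=> rf fc; have [f' [rf' _ f'0]] := almost_rational_derive1 rf.
have f'1 : f' != 0.
  by apply/eqP => /f'0[c fE]; have := fc c; rewrite fE eqxx.
elim: j i => [|j IH] i.
  by exists (cfrac C (i == 0%N)%:R); apply: cofinite_all => z; exact: rat_value_cst.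
have [g rg] := IH i; have [g' [rg' _ _]] := almost_rational_derive1 rg.
have [h rh] : exists h, almost_rational
    (fun z => if i is i'.+1 then chain_coef r j i' z else 0) h.
  case: i {g rg g' rg'} => [|i]; last exact: IH.
  by exists 0; apply: cofinite_all => z; have := rat_value_cst 0 z; rewrite rmorph0.
exists ((g' + h) / f'); apply: almost_rational_div rf' => //.
by apply: cofiniteW (cofiniteI rg' rh) => z [? ?]; apply: rat_valueD.
Qed.

End ChainCoefficients.

Section MpolyValues.
Variables (C : numClosedFieldType) (n : nat).
Local Notation Z := {fraction {poly C}}.

Definition mpoly_value (z : C) (G : mpoly n Z) (g : mpoly n C) :=
  forall mu, rat_value (mcoeff mu G) z (mcoeff mu g).

Lemma rat_value0 (z : C) : rat_value 0 z 0.
Proof. by have := rat_value_cst 0 z; rewrite rmorph0. Qed.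

Lemma rat_value1 (z : C) : rat_value 1 z 1.
Proof. by have := rat_value_cst 1 z; rewrite rmorph1. Qed.

Lemma rat_value_sum (I : Type) (r : seq I) (P : pred I) (f : I -> Z)
    (F : I -> C) z :
  (forall i, rat_value (f i) z (F i)) ->
  rat_value (\sum_(i <- r | P i) f i) z (\sum_(i <- r | P i) F i).
Proof.
move=> h; apply: (big_ind2 (fun f v => rat_value f z v)) => //.
- exact: rat_value0.
- by move=> x y x' y'; apply: rat_valueD.
Qed.

Lemma mpoly_valueC z f v : rat_value f z v ->
  mpoly_value z (mpolyC n f) (mpolyC n v).
Proof.
move=> fv mu; rewrite !mcoeffC; apply: rat_valueM => //.
by case: (mu == _); [exact: rat_value1|exact: rat_value0].
Qed.

Lemma mpoly_valueD z G g H h : mpoly_value z G g -> mpoly_value z H h ->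
  mpoly_value z (G + H) (g + h).
Proof. by move=> Gg Hh mu; rewrite !mcoeffD; apply: rat_valueD. Qed.

Lemma mpoly_valueM z G g H h : mpoly_value z G g -> mpoly_value z H h ->
  mpoly_value z (G * H) (g * h).
Proof.
move=> Gg Hh mu; rewrite !mcoeffM; apply: rat_value_sum => i.
exact: rat_valueM.
Qed.

Lemma mpoly_value0 z : mpoly_value z 0 0.
Proof. by move=> mu; rewrite !mcoeff0; exact: rat_value0. Qed.

Lemma mpoly_value1 z : mpoly_value z 1 1.
Proof. by have := mpoly_valueC (rat_value1 z); rewrite !rmorph1. Qed.

Lemma mpoly_value_linear z (m : nat) (f : 'I_m -> Z) (F : 'I_m -> C)
    (v : 'I_m -> 'I_n) :
  (forall i, rat_value (f i) z (F i)) ->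
  mpoly_value z (\sum_(i < m) f i *: mpolyX Z (mnm1 (v i)))
                (\sum_(i < m) F i *: mpolyX C (mnm1 (v i))).
Proof.
move=> fF; apply: (big_ind2 (mpoly_value z)) => [||i _].
- exact: mpoly_value0.
- by move=> x y x' y'; apply: mpoly_valueD.
move=> mu; rewrite !mcoeffZ !mcoeffX; apply: rat_valueM => //.
by case: (_ == _); [exact: rat_value1|exact: rat_value0].
Qed.

End MpolyValues.

Section Branch.
Variables (R : realType) (K : fieldType).
Local Notation C := (Cx R).
Local Notation Z := {fraction {poly C}}.
Variable iota : {rmorphism {fraction {poly C}} -> K}.
Variables (m : nat) (Fi : nat -> set K) (delta : 'I_m -> K) (e : 'I_m -> nat).
Hypothesis tower : radical_tower iota Fi delta e.
Variables (D : set C) (d : 'I_m -> C -> C).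
Hypothesis br : branches iota delta D d.

Let te := tower_hom iota delta.
Let V := tower_variety D d.
Let psi (x : C) := pcons x (d ^~ x).

Lemma branch_ideal P : te P = 0 <-> forall x, D x -> meval (psi x) P = 0.
Proof. exact: (branches_embedding br). Qed.

Lemma branch_in_variety x : D x -> V (psi x).
Proof. by move=> Dx P; apply; exists x. Qed.

Lemma tower_ideal_vanish p P : V p -> te P = 0 -> meval p P = 0.
Proof. by move=> Vp /branch_ideal P0; apply: Vp => _ [x Dx ->]; exact: P0. Qed.

Lemma tower_valueE a p v :
  tower_value iota delta a p v <-> fraction_value te (meval p) a v.
Proof. by []. Qed.

Lemma tower_value_uniq a p v w : V p -> tower_value iota delta a p v ->
  tower_value iota delta a p w -> v = w.
Proof.
move=> Vp; apply: (@fraction_value_uniq _ _ _ te (meval p)) => P.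
exact: tower_ideal_vanish.
Qed.

Lemma tower_funE a p v : V p -> tower_value iota delta a p v ->
  tower_fun iota delta a p = v.
Proof.
by move=> Vp av; apply: xget_unique => // w aw; exact: (tower_value_uniq Vp aw av).
Qed.

Lemma cofinite_branch P : te P != 0 ->
  cofinite (fun x => D x -> meval (psi x) P != 0).
Proof.
move=> P0; have [c [G [c0 ec]]] := tower_divides_univariate tower P0.
apply: cofiniteW (finite_roots c0) => x cx Dx.
have : te (univariate _ m c - P * G) = 0 by rewrite rmorphB ec subrr.
move=> /branch_ideal/(_ _ Dx); rewrite mevalB mevalM meval_univariate /psi pcons0.
by move=> /subr0_eq cE; apply: contra_neq cx => Px; rewrite cE Px mul0r.
Qed.

Lemma cofinite_branch_value a :
  cofinite (fun x => D x -> exists v, tower_value iota delta a (psi x) v /\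
                                      (a != 0 -> v != 0)).
Proof.
have [N [E [E0 ea]]] := tower_generated tower a.
have [N0|N0] := eqVneq (te N) 0.
  apply: cofiniteW (cofinite_branch E0) => x h Dx.
  exists (meval (psi x) N / meval (psi x) E); split.
    by exists N, E; split=> //; exact: h.
  by rewrite ea -/te N0 mul0r eqxx.
apply: cofiniteW (cofiniteI (cofinite_branch N0) (cofinite_branch E0)) => x [h h'] Dx.
exists (meval (psi x) N / meval (psi x) E); split.
  by exists N, E; split=> //; exact: h'.
by rewrite mulf_neq0 ?invr_eq0 ?h ?h'.
Qed.

Section Parametrization.
Variable q : 'I_m.+1 -> Z.
Hypothesis par : rational_parametrization V q.

Lemma tower_kernel P : te P = 0 <-> param_eval q P = 0.
Proof.
have /parametrization_ideal <- := par; rewrite branch_ideal.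
by split=> [h _ [x Dx ->]|h x Dx]; [exact: h|apply: h; exists x].
Qed.

(** This is a |-> a(r(z)): it maps x to r(z) and delta to delta(r(z)), and it
    exists because x, delta and Q(z) satisfy the same polynomial relations. *)
Lemma tower_pullback :
  exists phi : {rmorphism K -> Z}, forall P, phi (te P) = param_eval q P.
Proof. exact: fraction_lift tower_kernel (tower_generated tower). Qed.

Lemma param_nonconstant c : q ord0 != cfrac C c.
Proof.
rewrite -subr_eq0; apply/eqP => e0.
have : param_eval q (mpolyX C (mnm1 ord0) - mpolyC m.+1 c) = 0.
  by rewrite rmorphB /= mmapX mmap1U mmapC.
move=> /tower_kernel/eqP; rewrite rmorphB tower_homX tower_homC pcons0 -rmorphB.
by rewrite fmorph_eq0 -rmorphB tofrac_eq0 polyXsubC_eq0.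
Qed.

Lemma param_valueE z p : param_value q z p -> p = (fun i => rat_fun (q i) z).
Proof. by move=> qp; apply/funext => i; rewrite (rat_funE (qp i)). Qed.

Lemma param_in_variety z p : param_value q z p -> V p.
Proof. by move=> qp; have [sub _] := par; apply: sub; exists z. Qed.

Section Pullback.
Variable phi : {rmorphism K -> Z}.
Hypothesis phiE : forall P, phi (te P) = param_eval q P.

Lemma pullback_value a z p v : param_value q z p ->
  tower_value iota delta a p v -> rat_value (phi a) z v.
Proof.
move=> qp [N [E [E0 -> pE ->]]]; rewrite fmorph_div.
apply: rat_value_div => //; rewrite -[tower_eval _ _ _]/(te _) phiE;
  exact: param_value_eval.
Qed.

Lemma cofinite_tower_defined a :
  cofinite (fun z => tower_defined iota delta a (fun i => rat_fun (q i) z)).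
Proof.
have [N [E [E0 ea]]] := tower_generated tower a.
have qE0 : param_eval q E != 0 by apply: contra_neq E0 => /tower_kernel.
apply: cofiniteW (cofiniteI (cofinite_param q) (cofinite_neq0 qE0)).
move=> z [[p qp] h]; rewrite -(param_valueE qp).
exists (meval p N / meval p E), N, E; split=> //.
exact/h/param_value_eval.
Qed.

Lemma cofinite_pullback a : cofinite (fun z =>
  rat_value (phi a) z (tower_fun iota delta a (fun i => rat_fun (q i) z))).
Proof.
apply: cofiniteW (cofiniteI (cofinite_param q) (cofinite_tower_defined a)).
move=> z [[p qp] [v]]; rewrite -(param_valueE qp) => av.
rewrite (tower_funE (param_in_variety qp) av).
exact: pullback_value av.
Qed.

End Pullback.

Lemma param_almost_rational i : almost_rational (rat_fun (q i)) (q i).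
Proof.
apply: cofiniteW (cofinite_param q) => z [p qp].
by rewrite (rat_funE (qp i)).
Qed.

Lemma cofinite_eqB_defined s (F : mpoly s.+1 K) :
  cofinite (eqB_defined iota delta F q).
Proof.
have [f' [rf' _ f'0]] := almost_rational_derive1 (param_almost_rational ord0).
have f'1 : f' != 0.
  by apply/eqP => /f'0[c fE]; have := param_nonconstant c; rewrite fE eqxx.
have c1 := @cofinite_forall_seq _ _ (msupp F) _
  (fun mu _ => cofinite_tower_defined (mcoeff mu F)).
apply: cofiniteW (cofiniteI (cofinite_param q)
  (cofiniteI c1 (cofiniteI rf' (cofinite_neq0 f'1)))) => z [qp [co [r' h]]].
by split=> //; exact: h.
Qed.

(** Replacing in F each coefficient c by phi c and each derivative by the chain
    rule over C(z) gives a polynomial G over C(z). Outside a finite set its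
    coefficients have values, and the evaluation at z turns G into (B). *)
Lemma transformed_equation_algebraic s (F : mpoly s.+1 K) :
  algebraicB iota delta F q.
Proof.
move=> mu; have [phi phiE] := tower_pullback.
have cc j i := chain_coef_rational j i (param_almost_rational ord0)
  param_nonconstant.
have [g gP] := choice (fun ji : nat * nat => cc ji.1 ji.2).
pose G : mpoly s.+1 Z := mmap (fun c => mpolyC s.+1 (phi c))
  (fun j : 'I_s.+1 => \sum_(i < s.+1) g (val j, val i) *: mpolyX Z (mnm1 i)) F.
exists (mcoeff mu G).
have c1 := @cofinite_forall_seq _ _ (msupp F) _
  (fun mu _ => cofinite_pullback phiE (mcoeff mu F)).
have c2 := cofinite_forall (fun j : 'I_s.+1 =>
  cofinite_forall (fun i : 'I_s.+1 => gP (val j, val i))).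
apply: cofiniteW (cofiniteI (cofinite_eqB_defined F) (cofiniteI c1 c2)).
move=> z [def [cphi ccc]]; split=> //.
apply: (mmap_ind2 (E := mpoly_value z)) => //.
- exact: mpoly_value0.
- exact: mpoly_value1.
- by move=> x y x' y'; apply: mpoly_valueD.
- by move=> x y x' y'; apply: mpoly_valueM.
- by move=> j; apply: mpoly_value_linear => i; exact: ccc.
by move=> nu nuF; apply: mpoly_valueC; exact: cphi.
Qed.

End Parametrization.
End Branch.

(** * The radical variety *)

Lemma mmap_morph (U S T : nzRingType) (n : nat) (f : {rmorphism S -> T})
    (c : U -> S) (b : 'I_n -> S) (P : mpoly n U) :
  f (mmap c b P) = mmap (f \o c) (f \o b) P.
Proof.
apply: (mmap_ind2 (E := fun x y => f x = y)) => //.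
- exact: rmorph0.
- exact: rmorph1.
- by move=> x y x' y' <- <-; rewrite rmorphD.
- by move=> x y x' y' <- <-; rewrite rmorphM.
Qed.

Section RadicalVariety.
Variables (R : realType) (K : fieldType).
Local Notation C := (Cx R).
Local Notation Z := {fraction {poly C}}.
Variable iota : {rmorphism {fraction {poly C}} -> K}.
Variables (m : nat) (Fi : nat -> set K) (delta : 'I_m -> K) (e : 'I_m -> nat).
Hypothesis tower : radical_tower iota Fi delta e.
Variables (D : set C) (d : 'I_m -> C -> C).
Hypothesis br : branches iota delta D d.
Variables (l : nat) (a : 'I_l -> K).

Let te := tower_hom iota delta.
Let psi (x : C) := pcons x (d ^~ x).
Let ea := tower_hom iota a.

Lemma radical_value x v P : D x ->
  (forall j, tower_value iota delta (a j) (psi x) (v j)) ->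
  tower_value iota delta (ea P) (psi x) (meval (pcons x v) P).
Proof.
move=> Dx av; apply/tower_valueE; apply: fraction_value_mmap => [mu _|i].
  have := fraction_value_base te (meval (psi x)) (mpolyC m.+1 (mcoeff mu P)).
  by rewrite /te tower_homC /= mevalC.
rewrite /pcons; case: unliftP => [j _|_] /=; first exact: av.
have := fraction_value_base te (meval (psi x)) (mpolyX C (mnm1 ord0)).
by rewrite /te tower_homX /= mevalXU /psi !pcons0.
Qed.

(** A nonzero element P(x, a) of the tower has a nonzero value at almost all
    points of D, so the relations between x and a in the tower are exactly the
    polynomials that vanish on the radical variety. *)
Lemma radical_ideal P : ea P = 0 <->
  forall x v, D x -> (forall j, tower_value iota delta (a j) (psi x) (v j)) ->
  meval (pcons x v) P = 0.
Proof.
split=> [P0 x v Dx av|van].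
  have := radical_value P Dx av; rewrite P0.
  move/(tower_value_uniq br (branch_in_variety Dx)); apply.
  have := fraction_value_base te (meval (psi x)) 0.
  by rewrite !rmorph0.
apply/eqP; apply: contraT => P0.
have [x0 Dx0] := branches_nonempty br.
have c1 := cofinite_branch_value tower br (ea P).
have c2 := cofinite_forall (fun j => cofinite_branch_value tower br (a j)).
have [x [Dx [/(_ Dx)[w [Pw w0]] h]]] :=
  open_cofinite (branches_open br) Dx0 (cofiniteI c1 c2).
have [v vP] := choice (fun j => h j Dx).
have av j : tower_value iota delta (a j) (psi x) (v j) by case: (vP j).
have := tower_value_uniq br (branch_in_variety Dx) Pw (radical_value P Dx av).
by rewrite van // => w0'; move: (w0 P0); rewrite w0' eqxx.
Qed.

(** In C(z), the image of C(x, a) is C(t) by the theorem of Lueroth. The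
    coordinates x and a, written as rational functions of t, parametrize the curve
    with t as the parameter, and t, written as a rational function of x and a, is
    the inverse. *)
Lemma radical_variety_rational : rational_curve (tower_variety D d) ->
  rational_curve (radical_variety iota delta D d a).
Proof.
move=> [q [par _]]; have [phi phiE] := tower_pullback tower br par.
pose b : 'I_l.+1 -> Z := pcons (q ord0) (phi \o a).
have phic c : phi (iota (cfrac C c)) = cfrac C c.
  by rewrite -(tower_homC iota delta) phiE /param_eval /= mmapC.
have phix : phi (iota (tofrac 'X)) = q ord0.
  have := phiE (mpolyX C (mnm1 ord0)).
  by rewrite tower_homX pcons0 => ->; rewrite /param_eval /= mmapX mmap1U.
have phib P : phi (ea P) = param_eval b P.
  apply: (mmap_ind2 (E := fun x y => phi x = y)) => //.
  - exact: rmorph0.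
  - exact: rmorph1.
  - by move=> x y x' y' <- <-; rewrite rmorphD.
  - by move=> x y x' y' <- <-; rewrite rmorphM.
  - by move=> i; rewrite /b /pcons; case: unliftP.
  by move=> mu _; exact: phic.
have kerb P : ea P = 0 <-> param_eval b P = 0.
  by rewrite -phib; split=> [->|/eqP]; rewrite ?rmorph0 // fmorph_eq0 => /eqP.
pose L : set Z := [set y | exists N E, param_eval b E != 0 /\
  y = param_eval b N / param_eval b E].
have subL : is_subfield L by exact: quotients_subfield.
have baseL P : L (param_eval b P).
  by exists P, 1; rewrite rmorph1 oner_neq0 divr1.
have tofrac_inj : injective (@tofrac {poly C}).
  by move=> u v /eqP; rewrite tofrac_eq => /eqP.
have Lc c : L (cfrac C c).
  by have := baseL (mpolyC l.+1 c); rewrite /param_eval /= mmapC.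
have Lb i : L (b i).
  by have := baseL (mpolyX C (mnm1 i)); rewrite /param_eval /= mmapX mmap1U.
have nb0 c : b ord0 != cfrac C c.
  by rewrite /b pcons0; exact: (param_nonconstant br par).
have [t [[N [E [E0 et]]] tc Lt]] :=
  luroth tofrac_inj (@fraction_coprime C) subL Lc (Lb ord0) nb0.
(* The substitution of t for z. *)
pose ev : {rmorphism {poly C} -> Z} := (horner_eval t \o map_poly (cfrac C))%FUN.
have ker_ev u : tofrac u = 0 <-> ev u = 0.
  split=> [/eqP|/(transcendental_nonconstant tofrac_inj tc) ->]; last exact: rmorph0.
  by rewrite tofrac_eq0 => /eqP ->; rewrite rmorph0.
have [sigma sigmaE] : exists sigma : {rmorphism Z -> Z},
    forall u, sigma (tofrac u) = ev u.
  apply: fraction_lift ker_ev _ => y.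
  have [n [c [c0 ->]]] := fraction_quotient y.
  by exists n, c; rewrite tofrac_eq0.
have ex i : exists PQ : {poly C} * {poly C},
    ev PQ.2 != 0 /\ b i = ev PQ.1 / ev PQ.2.
  by have [P [Q h]] := Lt _ (Lb i); exists (P, Q); exact: h.
have [PQ bE] := choice ex.
pose q' i := tofrac (PQ i).1 / tofrac (PQ i).2.
have sq' P : sigma (param_eval q' P) = param_eval b P.
  rewrite /param_eval /= mmap_morph.
  have -> : sigma \o q' = b.
    by apply/funext => i; rewrite /= fmorph_div !sigmaE; have [_ ->] := bE i.
  have -> : (sigma \o cfrac C)%FUN = cfrac C :> (C -> Z) by
    apply/funext => c; rewrite /= sigmaE /ev /= map_polyC /horner_eval hornerC.
  by [].
have par' : rational_parametrization (radical_variety iota delta D d a) q'.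
  apply/parametrization_ideal => P.
  have -> : param_eval q' P = 0 <-> ea P = 0.
    rewrite kerb -sq'; split=> [->|/eqP]; first exact: rmorph0.
    by rewrite fmorph_eq0 => /eqP.
  rewrite radical_ideal; split=> [h x v Dx av|h _ [x Dx [v [av ->]]]].
    by apply: h; exists x => //; exists v.
  exact: h.
exists q'; split=> //; exists N, E; apply: (relation_inverse par').
  by move: E0; rewrite -sq' fmorph_eq0.
have sX : sigma (tofrac 'X) = t.
  by rewrite sigmaE /ev /= map_polyX /horner_eval hornerX.
apply: (fmorph_inj sigma).
by rewrite (rmorphM sigma) (sq' N) (sq' E) sX et divfK.
Qed.

End RadicalVariety.

(** * Transport of solutions *)

Lemma derive1_sum (K : numFieldType) (I : Type) (r : seq I) (h : I -> K -> K) x :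
  (forall i, derivable (h i) x 1) ->
  derivable (fun y => \sum_(i <- r) h i y) x 1 /\
  derive1 (fun y => \sum_(i <- r) h i y) x = \sum_(i <- r) derive1 (h i) x.
Proof.
move=> dh; elim: r => [|i r [dr er]].
  have -> : (fun y => \sum_(i <- [::]) h i y) = cst 0.
    by apply/funext => y; rewrite big_nil.
  by split; [exact: derivable_cst|rewrite derive1_cst big_nil].
have -> : (fun y => \sum_(j <- i :: r) h j y) = h i \+ (fun y => \sum_(i <- r) h i y).
  by apply/funext => y; rewrite big_cons.
have [ds es] := derive1D (dh i) dr.
by split=> //; rewrite es er big_cons.
Qed.

Lemma continuous_mmap (K : numFieldType) (U : nzRingType) n x
    (c : K -> U -> K) (h : K -> 'I_n -> K) (P : mpoly n U) :
  (forall mu, mu \in msupp P -> {for x, continuous (fun y => c y (mcoeff mu P))}) ->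
  (forall i, {for x, continuous (h ^~ i)}) ->
  {for x, continuous (fun y => mmap (c y) (h y) P)}.
Proof.
move=> cc ch; rewrite /mmap.
have cmon mu : {for x, continuous (fun y => mmap1 (h y) mu)}.
  rewrite /mmap1; elim: (index_enum _) => [|i r IH].
    have -> : (fun y => \prod_(i <- [::]) h y i ^+ mu i) = cst 1.
      by apply/funext => y; rewrite big_nil.
    exact: cst_continuous.
  have -> : (fun y => \prod_(j <- i :: r) h y j ^+ mu j) =
      (fun y => h y i ^+ mu i) \* (fun y => \prod_(i <- r) h y i ^+ mu i).
    by apply/funext => y; rewrite big_cons.
  apply: continuousM IH; elim: (mu i) => [|k IHk].
    have -> : (fun y => h y i ^+ 0) = cst 1 by apply/funext => y; rewrite expr0.
    exact: cst_continuous.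
  have -> : (fun y => h y i ^+ k.+1) = (h ^~ i) \* (fun y => h y i ^+ k).
    by apply/funext => y; rewrite exprS.
  exact: continuousM (ch i) IHk.
elim: (msupp P) cc => [|mu r IH] cc.
  have -> : (fun y => \sum_(mu <- [::]) c y (mcoeff mu P) * mmap1 (h y) mu) = cst 0.
    by apply/funext => y; rewrite big_nil.
  exact: cst_continuous.
have -> : (fun y => \sum_(nu <- mu :: r) c y (mcoeff nu P) * mmap1 (h y) nu) =
    ((fun y => c y (mcoeff mu P)) \* (fun y => mmap1 (h y) mu)) \+
    (fun y => \sum_(nu <- r) c y (mcoeff nu P) * mmap1 (h y) nu).
  by apply/funext => y; rewrite big_cons.
apply: continuousD; last by apply: IH => nu nur; apply: cc; rewrite inE nur orbT.
by apply: continuousM => //; apply: cc; rewrite inE eqxx.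
Qed.

Section Openness.
Variable K : numFieldType.

Lemma open_neq0 : open [set y : K | y != 0].
Proof.
rewrite openE => y y0; apply: (@cofinite_near K (fun y => y != 0)) => //.
apply: (sub_finite_set _ (finite_set1 (0 : K))) => z /= /negP.
by rewrite negbK => /eqP.
Qed.

Lemma near_imply (P Q : K -> Prop) (x : K) : (forall y, P y -> Q y) ->
  (\forall y \near x, P y) -> \forall y \near x, Q y.
Proof. by move=> PQ; apply: filterS. Qed.

Lemma near_continuous (f : K -> K) (P : K -> Prop) x :
  {for x, continuous f} -> (\forall z \near f x, P z) ->
  \forall y \near x, P (f y).
Proof. by move=> cf; exact: (cf [set z | P z]). Qed.

Lemma open_preimage (D O : set K) (f : K -> K) : open D -> open O ->
  (forall x, D x -> {for x, continuous f}) -> open [set x | D x /\ O (f x)].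
Proof.
move=> oD oO cf; rewrite openE => x [Dx Ofx].
apply: filterI; first exact: open_nbhs_nbhs.
by apply: (cf x Dx); apply: open_nbhs_nbhs.
Qed.

Lemma continuous_eq0 (f : K -> K) (U : set K) (P : K -> Prop) x :
  {for x, continuous f} -> open U -> U x -> cofinite P ->
  (forall y, U y -> P y -> f y = 0) -> f x = 0.
Proof.
move=> cf oU Ux cP f0; apply/eqP; apply: contraT => fx0.
have nz : \forall y \near x^', f y != 0.
  apply: nbhs_dnbhs; apply: (cf [set y | y != 0]); apply: open_nbhs_nbhs.
  by split=> //; exact: open_neq0.
have nU : \forall y \near x^', U y.
  by apply: nbhs_dnbhs; apply: open_nbhs_nbhs.
have [y [fy [Uy Py]]] :=
  @filter_ex _ _ _ _ (filterI nz (filterI nU (cofinite_dnbhs x cP))).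
by rewrite f0 ?eqxx in fy.
Qed.

End Openness.

Section Solutions.
Variables (R : realType) (K : fieldType).
Local Notation C := (Cx R).
Local Notation Z := {fraction {poly C}}.
Variable iota : {rmorphism {fraction {poly C}} -> K}.
Variables (m : nat) (Fi : nat -> set K) (delta : 'I_m -> K) (e : 'I_m -> nat).
Hypothesis tower : radical_tower iota Fi delta e.
Variables (D : set C) (d : 'I_m -> C -> C).
Hypothesis br : branches iota delta D d.
Variable q : 'I_m.+1 -> Z.
Hypothesis par : rational_parametrization (tower_variety D d) q.
Variables hN hE : mpoly m.+1 C.
Hypothesis inv : inverse_parametrization (tower_variety D d) q hN hE.

Let te := tower_hom iota delta.
Let psi (x : C) := pcons x (d ^~ x).
Let g x := meval (psi x) hN / meval (psi x) hE.
Let r := rat_fun (q ord0).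

Let U0 := [set x | D x /\ meval (psi x) hE != 0].

Lemma smooth_polynomial n P : smooth n D (fun x => meval (psi x) P).
Proof.
have oD := branches_open br.
apply: smooth_meval => // i; rewrite /psi /pcons.
case: unliftP => [j _|_] /=; last exact: smooth_id.
have [_ dj] := branches_holomorphic br j.
exact: (proj2 (smooth_iter D (d j)) dj n).
Qed.

Lemma open_U0 : open U0.
Proof.
apply: (open_preimage (f := fun x => meval (psi x) hE) (branches_open br)
  (@open_neq0 C)) => x Dx; apply: derivable1_continuous.
exact: smooth_derivable (smooth_polynomial 0 hE) Dx.
Qed.

Lemma smooth_quotient N E n U : open U -> U `<=` D ->
  (forall x, U x -> meval (psi x) E != 0) ->
  smooth n U (fun x => meval (psi x) N / meval (psi x) E).
Proof.
move=> oU UD E0; apply: smoothM => //; first exact: smooth_sub (smooth_polynomial n N).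
by apply: smoothV => //; exact: smooth_sub (smooth_polynomial n E).
Qed.

Lemma smooth_g n : smooth n U0 g.
Proof. by apply: smooth_quotient; [exact: open_U0|move=> x []|move=> x []]. Qed.

Lemma continuous_g x : U0 x -> {for x, continuous g}.
Proof. by move=> ?; apply/derivable1_continuous/(smooth_derivable (smooth_g 0)). Qed.

Lemma g_section x p : U0 x -> param_value q (g x) p -> p = psi x.
Proof.
move=> [Dx Ex]; have [_ _ h] := inv.
by apply: h => //; exact: branch_in_variety.
Qed.

(** The function h(x, delta(x)) takes the value z0 at the zeros of hN - z0 hE,
    which is a nonzero element of the tower: on Q(z) it is (z - z0) hE(Q(z)). *)
Lemma cofinite_g (P : C -> Prop) : cofinite P ->
  cofinite (fun x => U0 x -> P (g x)).
Proof.
move=> /finite_seqP[s Ps].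
have [E0 eN] := inverse_relation par inv.
have fib z : cofinite (fun x => U0 x -> g x != z).
  have P0 : te (hN - mpolyC m.+1 z * hE) != 0.
    apply/eqP => /(tower_kernel br par); rewrite rmorphB rmorphM eN.
    rewrite {2}/param_eval /= mmapC -mulrBl => /eqP.
    rewrite mulf_eq0 (negbTE E0) orbF -rmorphB tofrac_eq0.
    by rewrite polyXsubC_eq0.
  apply: cofiniteW (cofinite_branch tower br P0) => x h [Dx Ex].
  have := h Dx; rewrite mevalB mevalM mevalC; apply: contra_neq => <-.
  by rewrite divfK // subrr.
have := @cofinite_forall_seq _ _ s _ (fun z _ => fib z).
apply: cofiniteW => x h Ux; apply: contrapT => nP.
have : [set` s] (g x) by rewrite -Ps.
by move=> /= gs; have := h _ gs Ux; rewrite eqxx.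
Qed.

Section ChainRule.
Variables (s : nat) (F : mpoly s.+1 K).

Let regular z :=
  eqB_defined iota delta F q z /\
  derivable r z 1 /\
  forall ji : 'I_s.+1 * 'I_s.+1, derivable (chain_coef r ji.1 ji.2) z 1.

Lemma cofinite_regular_point : cofinite regular.
Proof.
apply: cofiniteI; first exact: (cofinite_eqB_defined tower br par).
have rr : almost_rational r (q ord0) := param_almost_rational q ord0.
have [_ [_ dr _]] := almost_rational_derive1 rr.
apply: cofiniteI => //; apply: cofinite_forall => ji.
have [f rf] := chain_coef_rational ji.1 ji.2 rr (param_nonconstant br par).
by have [_ [_ ? _]] := almost_rational_derive1 rf.
Qed.

Lemma near_regular (W : set C) x : open W -> U0 x -> W (g x) -> regular (g x) ->
  \forall y \near x, [/\ U0 y, W (g y) & regular (g y)].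
Proof.
move=> oW Ux Wx rx.
have n1 : \forall y \near x, U0 y by apply: open_nbhs_nbhs; split=> //; exact: open_U0.
have n2 : \forall z \near g x, W z by apply: open_nbhs_nbhs.
have n3 := cofinite_near cofinite_regular_point rx.
have n4 : \forall y \near x, W (g y) /\ regular (g y).
  apply: (@near_continuous _ g (fun z => W z /\ regular z) x (continuous_g Ux)).
  exact: filterI n2 n3.
by apply: near_imply (filterI n1 n4) => y [Uy [Wy ry]].
Qed.

Lemma r_g x : U0 x -> regular (g x) -> r (g x) = x.
Proof.
move=> Ux [[[p qp] _ _] _].
have -> : r (g x) = p ord0 by apply/rat_funE/qp.
by rewrite (g_section Ux qp) /psi pcons0.
Qed.

Lemma derive1_g x : U0 x -> regular (g x) -> derive1 g x = (derive1 r (g x))^-1.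
Proof.
move=> Ux rx; have [[_ r'0 _] [dr _]] := rx.
have dg : derivable g x 1 by apply: (smooth_derivable (smooth_g 0)).
have [drg erg] := derive1_chain dg dr.
have nr : \forall y \near x, (r \o g) y = id y.
  have := near_regular openT Ux I rx.
  by apply: near_imply => y [Uy _ ry]; exact: r_g.
have [_] := derive1_near nr drg; rewrite erg derive1E derive_id => e1.
by apply: (mulfI r'0); rewrite -e1 mulfV.
Qed.

(** By induction on j, with g' = 1 / r'(g) because g is a section of r. The
    formula holds at all points near x, hence can be differentiated. *)
Lemma chain_rule (W : set C) (Y : C -> C) j x : holomorphic W Y ->
  (j <= s)%N -> U0 x -> W (g x) -> regular (g x) ->
  derive1n j (Y \o g) x =
  \sum_(i < s.+1) chain_coef r j i (g x) * derive1n i Y (g x).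
Proof.
move=> [oW hY]; elim: j x => [|j IH] x js Ux Wx rx.
  rewrite big_ord_recl /= mul1r big1 ?addr0 // => i _; rewrite mul0r //.
have near := near_regular oW Ux Wx rx.
have nearE : \forall y \near x,
    \sum_(i < s.+1) (chain_coef r j i \* derive1n i Y) (g y) =
    derive1n j (Y \o g) y.
  apply: near_imply near => y [Uy Wy ry].
  exact: esym (IH _ (ltnW js) Uy Wy ry).
have [[_ r'0 _] [dr dc]] := rx.
have dg : derivable g x 1 by apply: (smooth_derivable (smooth_g 0)).
have dcY (i : 'I_s.+1) :=
  derive1M (dc (Ordinal (ltnW js : (j < s.+1)%N), i)) (hY i _ Wx).
have dterm (i : 'I_s.+1) := derive1_chain dg (proj1 (dcY i)).
have [dS eS] := derive1_sum (index_enum _) (fun i => proj1 (dterm i)).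
have [_ eD] := derive1_near nearE dS.
rewrite derive1nS eD eS.
under eq_bigr => i _ do rewrite (proj2 (dterm i)) (proj2 (dcY i)) derive1_g //=.
under [RHS]eq_bigr => i _ do rewrite /= !mulrDl.
rewrite [RHS]big_split /=.
under eq_bigr => i _ do rewrite mulrDl.
rewrite [LHS]big_split /=; congr (_ + _).
  by apply: eq_bigr => i _; rewrite mulrAC.
rewrite big_ord_recr [RHS]big_ord_recl /= chain_coef_gt //= !mul0r addr0 add0r.
by apply: eq_bigr => i _; rewrite /= mulrAC.
Qed.

(** Since q(g(x)) = (x, delta(x)), the coefficients of (B) at g(x) are those of
    (A) at x, and the chain rule identifies the derivatives. *)
Lemma equation_at_regular (W : set C) (Y : C -> C) x :
  solutionB iota delta F q W Y -> U0 x -> W (g x) -> regular (g x) ->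
  mmap (fun c => tower_fun iota delta c (psi x))
       (fun j : 'I_s.+1 => derive1n j (Y \o g) x) F = 0.
Proof.
move=> [hY eqn] Ux Wx rx; have [def _] := rx; have [[p qp] _ _] := def.
rewrite -(eqn _ Wx def).
apply: (mmap_ind2
  (E := fun a P => a = meval (fun i : 'I_s.+1 => derive1n i Y (g x)) P)) => //.
- by rewrite meval0.
- by rewrite meval1.
- by move=> a P a' P' -> ->; rewrite mevalD.
- by move=> a P a' P' -> ->; rewrite mevalM.
- move=> j; apply: (etrans (chain_rule hY (leq_ord j) Ux Wx rx)).
  rewrite raddf_sum; apply: eq_bigr => i _.
  by rewrite [RHS]mevalZ mevalXU.
by move=> mu _; rewrite mevalC -(param_valueE qp) (g_section Ux qp).
Qed.

End ChainRule.

Lemma continuous_tower_fun a x : D x -> tower_defined iota delta a (psi x) ->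
  {for x, continuous (fun y => tower_fun iota delta a (psi y))}.
Proof.
move=> Dx [_ [N [E [E0 aE Ex _]]]].
pose UE := [set y | D y /\ meval (psi y) E != 0].
have oUE : open UE.
  apply: (open_preimage (f := fun y => meval (psi y) E) (branches_open br)
    (@open_neq0 C)) => y Dy.
  apply: derivable1_continuous.
  exact: smooth_derivable (smooth_polynomial 0 E) Dy.
have dNE : derivable (fun y => meval (psi y) N / meval (psi y) E) x 1.
  apply: (smooth_derivable (n := 0) (U := UE)) => //.
  by apply: smooth_quotient => // y [].
have nUE : \forall y \near x, UE y by apply: open_nbhs_nbhs.
have near : \forall y \near x,
    meval (psi y) N / meval (psi y) E = tower_fun iota delta a (psi y).
  apply: near_imply nUE => y [Dy Ey]; apply/esym.
  by apply: (tower_funE br (branch_in_variety Dy)); exists N, E.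
by have [/derivable1_continuous] := derive1_near near dNE.
Qed.

(** The points x with g(x) not regular are isolated, as g takes each value
    finitely often: there (A) follows from the nearby points by continuity. *)
Lemma solution_pushforward s (F : mpoly s.+1 K) (W : set C) (Y : C -> C) :
  solutionB iota delta F q W Y ->
  solutionA iota delta D d F
    [set x | [/\ D x, meval (psi x) hE != 0 & W (g x)]] (Y \o g).
Proof.
move=> sol; have [[oW dY] _] := sol; set U := [set x | _].
have UE : U = [set x | U0 x /\ W (g x)].
  by apply/seteqP; split=> x; [move=> [? ? ?]|move=> [[? ?] ?]].
have oU : open U.
  by rewrite UE; exact: open_preimage open_U0 oW continuous_g.
have UU0 : U `<=` U0 by rewrite UE => x [].
have hYg n : smooth n U (Y \o g).
  apply: (@smooth_comp _ U oU n W g Y); first by move=> x [].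
    exact: smooth_sub (smooth_g n).
  exact: (proj2 (smooth_iter W Y) dY n).
have dYg := proj1 (smooth_iter U (Y \o g)) hYg.
split=> [x []//|//|x Ux codef].
have Dx : D x by case: Ux.
have cr := cofinite_g (cofinite_regular_point F).
apply: (@continuous_eq0 _ (fun y =>
  mmap (fun c => tower_fun iota delta c (psi y))
       (fun j : 'I_s.+1 => derive1n j (Y \o g) y) F) U _ x _ oU Ux cr).
  apply: (continuous_mmap (c := fun y c => tower_fun iota delta c (psi y)))
    => [mu muF|j].
    by apply: continuous_tower_fun => //; exact: codef.
  by apply: derivable1_continuous; exact: dYg.
move=> y Uy ry.
apply: (equation_at_regular sol) => //; [exact: UU0|by case: Uy|exact/ry/UU0].
Qed.

End Solutions.

(** * Rationality, algebraicity and solutions *)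

Theorem corollary3p4 (R : realType) (K : fieldType)
  (iota : {rmorphism {fraction {poly (Cx R)}} -> K})
  (m : nat) (Fi : nat -> set K) (delta : 'I_m -> K) (e : 'I_m -> nat)
  (htower : radical_tower iota Fi delta e)
  (D : set (Cx R)) (d : 'I_m -> Cx R -> Cx R)
  (hbranches : branches iota delta D d)
  (s : nat) (F : mpoly s.+1 K) (l : nat) (a : l.-tuple K)
  (ha : perm_eq a
          [seq c <- [seq mcoeff mu F | mu <- msupp F] | c \notin Fi 0%N])
  (hrat : rational_curve (tower_variety D d)) :
  [/\ rational_curve (radical_variety iota delta D d (tnth a)),
      forall q : 'I_m.+1 -> {fraction {poly (Cx R)}},
        rational_parametrization (tower_variety D d) q ->
        algebraicB iota delta F q
    & forall (q : 'I_m.+1 -> {fraction {poly (Cx R)}})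
        (hN hE : mpoly m.+1 (Cx R)),
        rational_parametrization (tower_variety D d) q ->
        inverse_parametrization (tower_variety D d) q hN hE ->
        forall (W : set (Cx R)) (Y : Cx R -> Cx R),
        solutionB iota delta F q W Y ->
        let h := fun p => meval p hN / meval p hE in
        let psi := fun x => pcons x (d ^~ x) in
        solutionA iota delta D d F
          [set x | [/\ D x, meval (psi x) hE != 0 & W (h (psi x))]]
          (fun x => Y (h (psi x)))].
Proof.
split.
- exact: (radical_variety_rational htower hbranches _ hrat).
- by move=> q par; exact: (transformed_equation_algebraic htower hbranches par).
move=> q hN hE par inv W Y sol h psi.
exact: (solution_pushforward htower hbranches par inv sol).
Qed.
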